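(* Let $p$ be a complex polynomial of degree $d \geq 2$ such that $H_p = p^{-1}(H_p) = J_p$, where $H_p=\operatorname{conv}J_p$. Then $p$ is affinely conjugate to the Chebyshev polynomial $T_d$ or to $-T_d$; that is, there exist $a\in\mathbb{C}\setminus\{0\}$, $b\in\mathbb{C}$ such that, with $g(z)=az+b$, one has $g\circ p\circ g^{-1} = T_d$ or $g\circ p\circ g^{-1} = -T_d$.
   Context: For a polynomial $p$ viewed as a holomorphic self-map of the Riemann sphere $\widehat{\mathbb{C}}$ (with $p(\infty)=\infty$), the Fatou set $F_p$ is the maximal open subset of $\widehat{\mathbb{C}}$ on which the iterates $\{p^{\circ n}\}_{n\in\mathbb{N}}$ form an equicontinuous family, and the Julia set $J_p$ is the complement $\widehat{\mathbb{C}}\setminus F_p$. $\operatorname{conv} X$ denotes the convex hull of $X \subset \mathbb{C}\cong\mathbb{R}^2$. The Chebyshev polynomial $T_d$ of degree $d$ is the polynomial satisfying $T_d(\cos z)=\cos(dz)$ for all $z$. *)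

(* Defs.v *)
From Stdlib Require Import Reals List.
From Coquelicot Require Import Coquelicot.
Open Scope R_scope.

Definition peval (cs : list C) (z : C) : C :=
  Stdlib.Lists.List.fold_right (fun c acc => Cplus c (Cmult z acc)) (RtoC 0) cs.

(* Riemann sphere: None = infinity. *)
Definition sphere := option C.

Definition chordal (x y : sphere) : R :=
  match x, y with
  | Some z, Some w =>
      2 * Cmod (Cminus z w) / sqrt ((1 + Cmod z ^ 2) * (1 + Cmod w ^ 2))
  | Some z, None | None, Some z => 2 / sqrt (1 + Cmod z ^ 2)
  | None, None => 0
  end.

Definition sext (f : C -> C) (x : sphere) : sphere :=
  match x with Some z => Some (f z) | None => None end.

Definition equicont_at (F : sphere -> sphere) (x : sphere) : Prop :=
  forall eps, 0 < eps -> exists delta, 0 < delta /\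
    forall y, chordal x y < delta ->
      forall n : nat, chordal (Nat.iter n F x) (Nat.iter n F y) < eps.

(* Fatou set: the union of all open sets on which the iterates are
   equicontinuous, i.e. x has an open ball all of whose points are points
   of equicontinuity. *)
Definition Fatou (F : sphere -> sphere) (x : sphere) : Prop :=
  exists r, 0 < r /\ forall y, chordal x y < r -> equicont_at F y.

Definition JuliaC (p : C -> C) (z : C) : Prop := ~ Fatou (sext p) (Some z).

Definition conv (X : C -> Prop) (z : C) : Prop :=
  exists l : list (prod R C),
    Stdlib.Lists.List.Forall (fun tx : prod R C => (0 <= fst tx)%R /\ X (snd tx)) l /\
    Stdlib.Lists.List.fold_right (fun (tx : prod R C) (s : R) => (fst tx + s)%R) 0%R l = 1%R /\
    z = Stdlib.Lists.List.fold_right (fun (tx : prod R C) (s : C) => Cplus (Cmult (RtoC (fst tx)) (snd tx)) s) (RtoC 0) l.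

Definition ccos (w : C) : C :=
  (cos (fst w) * cosh (snd w), - (sin (fst w) * sinh (snd w))).

(* Main.v *)
Require Import Defs.
From Stdlib Require Import Reals List Lra Lia Classical.
From Coquelicot Require Import Coquelicot.
From mathcomp Require all_boot all_order all_algebra complex Rstruct.
Open Scope R_scope.

(** The set H = J = conv J is compact and convex. It has empty interior, because on an open
    subset of H the iterates are uniformly bounded, hence equi-Lipschitz by a Cauchy estimate,
    so that such a set lies in the Fatou set. It is nonempty, and it is not a point, which would
    be superattracting. So H is a segment, and after an affine conjugation q^-1([-1,1]) = [-1,1].

    Let a be the leading coefficient of q, and let x range over the zeros of T_N. For y in
    [-1,1] all roots z_i of q - y lie in [-1,1], whence
    prod_x |q(x) - y| = |a|^N prod_i |T_N(z_i)| / 2^(N-1) <= |a|^N 2^(d(1-N)).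
    The left-hand side is, up to sign, monic of degree N in y, so it is at least 2^(1-N) for some y in
    [-1,1]. Letting N grow, |a| >= 2^(d-1). On the other hand 2d a / 2^(d-1) is the sum of
    (-1)^j q(cos(j pi/d)) over j < 2d, and all these terms lie in [-1,1]. Hence they are all
    equal to the same sign e, and q = e T_d since the two agree at d + 1 points. *)

(** * Polynomial functions *)

(* [a] is the coefficient of z^n, possibly 0: n bounds the degree of f. *)
Fixpoint deg_le (n : nat) (a : C) (f : C -> C) : Prop :=
  match n with
  | O => forall z, f z = a
  | S m => exists c g, deg_le m a g /\ forall z, f z = Cplus c (Cmult z (g z))
  end.

(** * The fundamental theorem of algebra, transported from MathComp *)

Module FTA.
Import all_boot all_order all_algebra complex Rstruct.
Import GRing.Theory.

Definition toRi (z : C) : complex R := Complex (fst z) (snd z).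

Lemma toRi_add (z w : C) : toRi (Cplus z w) = (toRi z + toRi w)%R.
Proof. by case: z w => [a b] [c d]. Qed.

Lemma toRi_mul (z w : C) : toRi (Cmult z w) = (toRi z * toRi w)%R.
Proof. by case: z w => [a b] [c d]. Qed.

Lemma toRi_inj (z w : C) : toRi z = toRi w -> z = w.
Proof. by case: z w => [a b] [c d] [-> ->]. Qed.

Lemma toRi_0 : toRi (RtoC 0) = 0%R.
Proof. by []. Qed.

(** The Horner form is rebuilt as a MathComp polynomial, so that [closed_rootP] can supply roots. *)
Lemma deg_le_poly n a f : deg_le n a f ->
  exists P : {poly complex R}, [/\ (size P <= n.+1)%N, (P`_n = toRi a)%R &
    forall z, (P.[toRi z] = toRi (f z))%R].
Proof.
elim: n f => [|n IH] f /=.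
  move=> H; exists (toRi a)%:P%R; split=> [||z].
  - exact: size_polyC_leq1.
  - by rewrite coefC.
  - by rewrite hornerC H.
move=> [c [g [/IH [P [sP cP hP]] H]]].
exists ((toRi c)%:P + P * 'X)%R; split=> [||z].
- rewrite (leq_trans (size_polyD _ _)) // geq_max.
  rewrite (leq_trans (size_polyC_leq1 _)) //=.
  by have [->|/size_mulX->] := eqVneq P 0%R; rewrite ?mul0r ?size_poly0.
- by rewrite coefD coefC coefMX /= add0r.
- by rewrite hornerD hornerC hornerMX hP H toRi_add toRi_mul mulrC.
Qed.

Lemma poly_root n a f :
  deg_le n.+1 a f -> a <> RtoC 0 -> exists z, f z = RtoC 0.
Proof.
move=> /deg_le_poly [P [sP cP hP]] a0.
have sz : (n.+1 < size P)%N.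
  rewrite ltnNge; apply/negP => h; apply: a0; apply: toRi_inj.
  by rewrite -cP toRi_0 nth_default.
have : size P != 1%N by rewrite neq_ltn (leq_trans _ sz) ?orbT.
move/closed_rootP => [[x y] /eqP r].
exists (x, y); apply: toRi_inj.
by rewrite -hP toRi_0.
Qed.
End FTA.

(** * Degree bounds, factorization and zeros *)

Lemma deg_le_ext n a f g :
  deg_le n a f -> (forall z, g z = f z) -> deg_le n a g.
Proof.
  destruct n; simpl; intros H E.
  - intros z; rewrite E; apply H.
  - destruct H as [c [h [Hh H]]]. exists c, h; split; auto.
    intros z; rewrite E; apply H.
Qed.

Lemma deg_le_add n : forall a b f g, deg_le n a f -> deg_le n b g ->
  deg_le n (a + b)%C (fun z => f z + g z)%C.
Proof.
  induction n; simpl; intros a b f g Hf Hg.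
  - intros z; now rewrite Hf, Hg.
  - destruct Hf as [c [f' [Hf' Hf]]], Hg as [e [g' [Hg' Hg]]].
    exists (c + e)%C, (fun z => f' z + g' z)%C; split; [now apply IHn|].
    intros z; rewrite Hf, Hg; ring.
Qed.

Lemma deg_le_scal n k : forall a f, deg_le n a f ->
  deg_le n (k * a)%C (fun z => k * f z)%C.
Proof.
  induction n; simpl; intros a f Hf.
  - intros z; now rewrite Hf.
  - destruct Hf as [c [f' [Hf' Hf]]].
    exists (k * c)%C, (fun z => k * f' z)%C; split; [now apply IHn|].
    intros z; rewrite Hf; ring.
Qed.

Lemma deg_le_S n : forall a f, deg_le n a f -> deg_le (S n) 0 f.
Proof.
  induction n; intros a f Hf.
  - exists a, (fun _ => RtoC 0); split; simpl; auto.
    intros z; rewrite (Hf z); ring.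
  - destruct Hf as [c [f' [Hf' Hf]]].
    exists c, f'; split; [now apply IHn with a|]; auto.
Qed.

Lemma deg_le_weaken n m a f : deg_le n a f -> (n < m)%nat -> deg_le m 0 f.
Proof.
  intros Hf Hm; induction Hm.
  - now apply deg_le_S with a.
  - now apply deg_le_S with (RtoC 0).
Qed.

Lemma deg_le_mulX n a f : deg_le n a f -> deg_le (S n) a (fun z => z * f z)%C.
Proof.
  intros Hf; exists (RtoC 0), f; split; auto. intros z; ring.
Qed.

Lemma deg_le_mul_affine n u v a f : deg_le n a f ->
  deg_le (S n) (u * a)%C (fun z => (u * z + v) * f z)%C.
Proof.
  intros Hf.
  apply deg_le_ext with (fun z => u * (z * f z) + v * f z)%C; [|intros; ring].
  replace (u * a)%C with (u * a + v * 0)%C by ring.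
  apply deg_le_add; apply deg_le_scal; [now apply deg_le_mulX|].
  now apply deg_le_S with a.
Qed.

Lemma deg_le_comp_affine n u v : forall a f, deg_le n a f ->
  deg_le n (a * u ^ n)%C (fun z => f (u * z + v)%C).
Proof.
  induction n; intros a f Hf.
  - simpl in *; intros z; rewrite Hf; ring.
  - destruct Hf as [c [g [Hg Hf]]].
    apply deg_le_ext with (fun z => c + (u * z + v) * g (u * z + v))%C;
      [|intros; apply Hf].
    replace (a * u ^ S n)%C with (0 + u * (a * u ^ n))%C by (rewrite Cpow_S; ring).
    apply deg_le_add.
    + apply deg_le_weaken with (n := 0%nat) (a := c); [simpl; auto | lia].
    + now apply (deg_le_mul_affine n u v _ (fun z => g (u * z + v)%C)), IHn.
Qed.

Lemma deg_le_factor n r : forall a f, deg_le (S n) a f ->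
  exists g, deg_le n a g /\ forall z, f z = (f r + (z - r) * g z)%C.
Proof.
  induction n; intros a f [c [f1 [Hf1 Hf]]].
  - exists (fun _ => a); split; [simpl; auto|].
    intros z; simpl in Hf1; rewrite !Hf, !Hf1; ring.
  - destruct (IHn a f1 Hf1) as [g1 [Hg1 E]].
    (* With f z = c + z f1(z), the difference f z - f r is (z - r) f1(r) + z (f1(z) - f1(r)), and
       the induction hypothesis divides the last bracket by z - r. *)
    exists (fun z => f1 r + z * g1 z)%C; split.
    + exists (f1 r), g1; auto.
    + intros z; rewrite !Hf, E; ring.
Qed.

Fixpoint prodC {A : Type} (f : A -> C) (l : list A) : C :=
  match l with nil => RtoC 1 | x :: l' => (f x * prodC f l')%C end.

Lemma prodC_ext {A} (f g : A -> C) l :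
  (forall x, In x l -> f x = g x) -> prodC f l = prodC g l.
Proof.
  induction l; simpl; auto; intros H.
  rewrite H, IHl; auto.
Qed.

Lemma prodC_eq0 {A} (f : A -> C) l : prodC f l = 0 -> exists x, In x l /\ f x = 0.
Proof.
  induction l; simpl; intros H.
  - exfalso; apply RtoC_inj in H; lra.
  - destruct (Ceq_dec (f a) 0) as [E|E]; [exists a; auto|].
    destruct IHl as [x [Hx Ex]]; [|exists x; auto].
    destruct (Ceq_dec (prodC f l) 0) as [E'|E']; auto.
    now destruct (Cmult_neq_0 _ _ E E').
Qed.

Lemma prodC_scal {A} (f : A -> C) k l :
  prodC (fun x => k * f x)%C l = (k ^ length l * prodC f l)%C.
Proof.
  induction l; simpl; [ring|]. rewrite IHl; ring.
Qed.

Lemma prodC_mul {A} (f g : A -> C) l :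
  prodC (fun x => f x * g x)%C l = (prodC f l * prodC g l)%C.
Proof.
  induction l; simpl; [ring|]. rewrite IHl; ring.
Qed.

Lemma prodC_swap {A B} (f : A -> B -> C) l m :
  prodC (fun x => prodC (f x) m) l = prodC (fun y => prodC (fun x => f x y) l) m.
Proof.
  induction l; simpl.
  - induction m; simpl; auto. rewrite <- IHm; ring.
  - now rewrite IHl, <- prodC_mul.
Qed.

Lemma Cmod_prodC_le {A} (f : A -> C) M l :
  (forall x, In x l -> Cmod (f x) <= M) -> Cmod (prodC f l) <= M ^ length l.
Proof.
  induction l; simpl; intros H.
  - rewrite Cmod_1; lra.
  - rewrite Cmod_mult. apply Rmult_le_compat; auto using Cmod_ge_0.
Qed.

Lemma deg_le_prod l : deg_le (length l) 1 (fun z => prodC (fun r => z - r)%C l).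
Proof.
  induction l as [|r l IH]; simpl length.
  - simpl; auto.
  - apply deg_le_ext with (fun z => (1 * z + - r) * prodC (fun r => z - r) l)%C.
    + replace (RtoC 1) with (1 * 1)%C at 1 by ring.
      now apply deg_le_mul_affine.
    + intros z; simpl; ring.
Qed.

Lemma deg_le_split n : forall a f, deg_le n a f -> a <> 0 ->
  exists l, length l = n /\ forall z, f z = (a * prodC (fun r => z - r) l)%C.
Proof.
  induction n; intros a f Hf Ha.
  - exists nil; split; auto. intros z; rewrite (Hf z); simpl; ring.
  - destruct (FTA.poly_root n a f Hf Ha) as [r Hr].
    destruct (deg_le_factor n r a f Hf) as [g [Hg E]].
    destruct (IHn a g Hg Ha) as [l [Hl E']].
    exists (r :: l); split; [simpl; auto|].
    intros z; rewrite E, Hr, E'; simpl; ring.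
Qed.

(** Each remaining zero differs from [r], hence is a zero of the quotient by z - r. The case a = 0
    is included, for use in [deg_le_eq0]. *)
Lemma deg_le_split_roots n : forall a f l, deg_le n a f -> length l = n -> NoDup l ->
  (forall r, In r l -> f r = 0) ->
  forall z, f z = (a * prodC (fun r => z - r) l)%C.
Proof.
  induction n; intros a f l Hf Hl Hnd Hr z.
  - destruct l; [|discriminate]. rewrite (Hf z); simpl; ring.
  - destruct l as [|r l]; [discriminate|].
    destruct (deg_le_factor n r a f Hf) as [g [Hg E]].
    rewrite (Hr r) in E by (simpl; auto).
    inversion Hnd as [|? ? Hin Hnd']; subst.
    rewrite E, (IHn a g l Hg); auto.
    + simpl; ring.
    + intros s Hs.
      destruct (Ceq_dec (g s) 0) as [G|G]; auto.
      assert (Hsr : (s - r)%C <> 0).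
      { intros H; apply Hin. replace r with s; auto.
        replace s with (s - r + r)%C by ring. rewrite H; ring. }
      destruct (Cmult_neq_0 _ _ Hsr G).
      rewrite <- (Hr s) by (simpl; auto). rewrite (E s); ring.
Qed.

(** All but one of the n + 1 zeros give f = a prod (z - s); the remaining one then forces a = 0. *)
Lemma deg_le_eq0 n a f l : deg_le n a f -> length l = S n -> NoDup l ->
  (forall r, In r l -> f r = 0) -> forall z, f z = 0.
Proof.
  destruct l as [|r l]; [discriminate|]; intros Hf Hl Hnd Hr z.
  inversion Hnd as [|? ? Hin Hnd']; subst; injection Hl as Hl.
  assert (E := deg_le_split_roots n a f l Hf Hl Hnd' (fun s Hs => Hr s (or_intror Hs))).
  destruct (Ceq_dec a 0) as [->|Ha]; [rewrite E; ring|].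
  exfalso; apply Hin.
  assert (E0 : (a * prodC (fun s => r - s) l)%C = 0)
    by (rewrite <- E; apply Hr; simpl; auto).
  destruct (Ceq_dec (prodC (fun s => r - s)%C l) 0) as [P|P].
  - destruct (prodC_eq0 _ _ P) as [s [Hs Es]].
    replace r with s; auto. replace r with (r - s + s)%C by ring. rewrite Es; ring.
  - now destruct (Cmult_neq_0 _ _ Ha P).
Qed.

Lemma peval_deg_le cs : forall n, length cs = S n ->
  deg_le n (nth n cs (RtoC 0)) (peval cs).
Proof.
  induction cs as [|c cs IH]; intros n Hn; [discriminate|].
  injection Hn as Hn. destruct n.
  - destruct cs; [|discriminate]. intros z; simpl; ring.
  - exists c, (peval cs); auto.
Qed.

(** * Products, iterates and growth of polynomials *)

Lemma deg_le_mul n : forall a f m b g, deg_le n a f -> deg_le m b g ->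
  exists k e, deg_le k e (fun z => f z * g z)%C.
Proof.
  induction n; intros a f m b g Hf Hg.
  - exists m, (a * b)%C.
    apply deg_le_ext with (fun z => a * g z)%C; [now apply deg_le_scal|].
    intros z; now rewrite (Hf z).
  - destruct Hf as [c [f' [Hf' Hf]]].
    destruct (IHn a f' m b g Hf' Hg) as [k [e H]].
    exists (S (S (k + m))), (0 + 0)%C.
    apply deg_le_ext with (fun z => c * g z + z * (f' z * g z))%C;
      [|intros z; rewrite Hf; ring].
    apply deg_le_add.
    + apply deg_le_weaken with m (c * b)%C; [now apply deg_le_scal|lia].
    + apply deg_le_weaken with (S k) e; [now apply deg_le_mulX|lia].
Qed.

Lemma deg_le_comp n : forall a f m b g, deg_le n a f -> deg_le m b g ->
  exists k e, deg_le k e (fun z => f (g z)).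
Proof.
  induction n; intros a f m b g Hf Hg.
  - exists O, a; intros z; apply Hf.
  - destruct Hf as [c [f' [Hf' Hf]]].
    destruct (IHn a f' m b g Hf' Hg) as [k [e H]].
    destruct (deg_le_mul m b g k e _ Hg H) as [k' [e' H']].
    exists (S k'), (0 + 0)%C.
    apply deg_le_ext with (fun z => c + g z * f' (g z))%C; [|intros z; now rewrite Hf].
    apply deg_le_add.
    + apply deg_le_weaken with O c; [simpl; auto|lia].
    + now apply deg_le_weaken with k' e'; [|lia].
Qed.

(** Degree and leading coefficient stay unspecified: the constant in [cauchy_lipschitz] depends on
    neither. *)
Lemma deg_le_iter n a f k : deg_le n a f ->
  exists m b, deg_le m b (Nat.iter k f).
Proof.
  intros Hf; induction k.
  - exists 1%nat, (RtoC 1), (RtoC 0), (fun _ => RtoC 1); split; simpl; auto.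
    intros z; ring.
  - destruct IHk as [m [b H]]. now apply (deg_le_comp n a f m b (Nat.iter k f)).
Qed.

(** From |f z| >= |z| |g z| - |c0|: beyond the enlarged radius |c0| is at most half of c |z|, so
    half of the constant survives each Horner step. *)
Lemma deg_le_growth n : forall a f, deg_le n a f -> a <> 0 ->
  exists R c, 1 <= R /\ 0 < c /\ forall z, R <= Cmod z -> c * Cmod z ^ n <= Cmod (f z).
Proof.
  induction n; intros a f Hf Ha.
  - exists 1, (Cmod a); repeat split; [lra|now apply Cmod_gt_0|].
    intros z _; rewrite (Hf z); simpl; lra.
  - destruct Hf as [c0 [g [Hg Hf]]].
    destruct (IHn a g Hg Ha) as [R [c [HR [Hc H]]]].
    exists (R + 2 * Cmod c0 / c), (c / 2).
    assert (H0 := Cmod_ge_0 c0).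
    assert (Hq : 0 <= 2 * Cmod c0 / c) by (apply Rdiv_le_0_compat; lra).
    repeat split; [lra|lra|].
    intros z Hz.
    assert (Hgz : c * Cmod z ^ n <= Cmod (g z)) by (apply H; lra).
    assert (H1 : Cmod z * Cmod (g z) - Cmod c0 <= Cmod (f z)).
    { rewrite <- Cmod_mult.
      replace (z * g z)%C with (f z + - c0)%C by (rewrite Hf; ring).
      generalize (Cmod_triangle (f z) (- c0)); rewrite Cmod_opp; lra. }
    assert (H2 : Cmod c0 <= c / 2 * Cmod z).
    { replace (Cmod c0) with (c / 2 * (2 * Cmod c0 / c)) by (field; lra).
      apply Rmult_le_compat_l; lra. }
    assert (H3 : 1 <= Cmod z ^ n) by (apply pow_R1_Rle; lra).
    assert (H4 : Cmod z * (c * Cmod z ^ n) <= Cmod z * Cmod (g z))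
      by (apply Rmult_le_compat_l; lra).
    assert (H5 : c / 2 * Cmod z * 1 <= c / 2 * Cmod z * Cmod z ^ n).
    { apply Rmult_le_compat_l; [apply Rmult_le_pos|]; lra. }
    simpl; nra.
Qed.

(** * Averages over roots of unity *)

Fixpoint sumC (f : nat -> C) (n : nat) : C :=
  match n with O => RtoC 0 | S m => (sumC f m + f m)%C end.

Lemma sumC_ext f g n : (forall j, (j < n)%nat -> f j = g j) -> sumC f n = sumC g n.
Proof.
  induction n; simpl; intros H; auto. rewrite IHn, H; auto.
Qed.

Lemma sumC_add f g n : sumC (fun j => f j + g j)%C n = (sumC f n + sumC g n)%C.
Proof.
  induction n; simpl; [ring|]. rewrite IHn; ring.
Qed.

Lemma sumC_scal k f n : sumC (fun j => k * f j)%C n = (k * sumC f n)%C.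
Proof.
  induction n; simpl; [ring|]. rewrite IHn; ring.
Qed.

Lemma sumC_const k n : sumC (fun _ => k) n = (RtoC (INR n) * k)%C.
Proof.
  induction n; [simpl; ring|]. rewrite S_INR, RtoC_plus; simpl sumC; rewrite IHn; ring.
Qed.

Lemma Cmod_sumC_le f M n : (forall j, (j < n)%nat -> Cmod (f j) <= M) ->
  Cmod (sumC f n) <= INR n * M.
Proof.
  induction n; intros H.
  - simpl; rewrite Cmod_0; lra.
  - rewrite S_INR; simpl sumC.
    eapply Rle_trans; [apply Cmod_triangle|].
    assert (H1 := H n (Nat.lt_succ_diag_r n)).
    assert (Cmod (sumC f n) <= INR n * M) by (apply IHn; auto). lra.
Qed.

Lemma Re_sumC f n : Re (sumC f n) = Re (sumC (fun j => RtoC (Re (f j))) n).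
Proof.
  induction n; unfold Re in *; simpl; auto. now rewrite IHn.
Qed.

Lemma sumC_RtoC h n : sumC (fun j => RtoC (h j)) n = RtoC (Re (sumC (fun j => RtoC (h j)) n)).
Proof.
  induction n; simpl; auto. rewrite IHn at 1. now rewrite <- RtoC_plus.
Qed.

Definition cis (t : R) : C := (cos t, sin t).

Lemma cis_add s t : cis (s + t) = (cis s * cis t)%C.
Proof.
  unfold cis, Cmult; simpl; rewrite cos_plus, sin_plus. f_equal; ring.
Qed.

Lemma cis_0 : cis 0 = 1.
Proof. unfold cis; now rewrite cos_0, sin_0. Qed.

Lemma cis_2PI_nat k : cis (INR k * (2 * PI)) = 1.
Proof.
  induction k; [simpl; rewrite Rmult_0_l; apply cis_0|].
  rewrite S_INR, Rmult_plus_distr_r, Rmult_1_l, cis_add, IHk.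
  unfold cis; rewrite cos_2PI, sin_2PI. change (1, 0) with (RtoC 1). ring.
Qed.

Lemma Cmod_cis t : Cmod (cis t) = 1.
Proof.
  unfold Cmod, cis; simpl.
  rewrite !Rmult_1_r. replace (cos t * cos t + sin t * sin t) with 1; [apply sqrt_1|].
  generalize (sin2_cos2 t); unfold Rsqr; lra.
Qed.

Lemma sumC_cis n t :
  (sumC (fun j => cis (INR j * t)) n * (cis t - 1) = cis (INR n * t) - 1)%C.
Proof.
  induction n.
  - simpl; rewrite Rmult_0_l, cis_0; ring.
  - rewrite S_INR, Rmult_plus_distr_r, Rmult_1_l, cis_add.
    simpl sumC; rewrite Cmult_plus_distr_r, IHn; ring.
Qed.

Lemma sumC_cis_root n k : (0 < k < n)%nat ->
  sumC (fun j => cis (INR j * (INR k * (2 * PI) / INR n))) n = 0.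
Proof.
  intros [Hk Hn]. apply lt_INR in Hk; apply lt_INR in Hn; simpl in Hk.
  set (t := INR k * (2 * PI) / INR n).
  assert (E := sumC_cis n t).
  replace (INR n * t) with (INR k * (2 * PI)) in E by (unfold t; field; lra).
  rewrite cis_2PI_nat in E.
  replace (1 - 1)%C with (RtoC 0) in E by ring.
  destruct (Ceq_dec (sumC (fun j => cis (INR j * t)) n) 0) as [H|H]; auto.
  destruct (Ceq_dec (cis t - 1)%C 0) as [H'|H'];
    [|now destruct (Cmult_neq_0 _ _ H H')].
  exfalso.
  (* If cis t were 1, then sin (t/2) would vanish, although 0 < t/2 < PI. *)
  assert (Hc : cos t = 1) by (apply (f_equal fst) in H'; simpl in H'; lra).
  replace t with (2 * (t / 2)) in Hc by field.
  rewrite cos_2a_sin in Hc.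
  assert (HPI := PI_RGT_0).
  assert (Ht : 0 < t / 2 < PI).
  { replace (t / 2) with (INR k / INR n * PI) by (unfold t; field; lra).
    assert (0 < INR k / INR n) by (apply Rdiv_lt_0_compat; lra).
    assert (INR k / INR n < 1).
    { apply Rmult_lt_reg_r with (INR n); [lra|]. unfold Rdiv.
      rewrite Rmult_assoc, Rinv_l; lra. }
    split; [apply Rmult_lt_0_compat; lra|nra]. }
  assert (0 < sin (t / 2)) by (apply sin_gt_0; lra). nra.
Qed.

(** Each factor z in the Horner form raises the frequency by one; all frequencies from k to k + m
    lie strictly between 0 and n, where the sums of roots of unity vanish. *)
Lemma sumC_cis_deg_le m : forall a f k n r, deg_le m a f -> (0 < k)%nat -> (k + m < n)%nat ->
  sumC (fun j => cis (INR j * (INR k * (2 * PI) / INR n)) *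
                 f (RtoC r * cis (INR j * (2 * PI / INR n))))%C n = 0.
Proof.
  induction m; intros a f k n r Hf Hk Hn.
  - rewrite (sumC_ext _ (fun j => a * cis (INR j * (INR k * (2 * PI) / INR n)))%C).
    + rewrite sumC_scal, sumC_cis_root; [ring|lia].
    + intros j _; rewrite (Hf _); ring.
  - destruct Hf as [c [g [Hg Hf]]].
    rewrite (sumC_ext _ (fun j => c * cis (INR j * (INR k * (2 * PI) / INR n)) +
      RtoC r * (cis (INR j * (INR (S k) * (2 * PI) / INR n)) *
                 g (RtoC r * cis (INR j * (2 * PI / INR n)))))%C).
    + rewrite sumC_add, !sumC_scal, sumC_cis_root by lia.
      rewrite (IHm a g (S k)) by (auto; lia). ring.
    + intros j _. rewrite Hf.
      replace (INR j * (INR (S k) * (2 * PI) / INR n))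
        with (INR j * (INR k * (2 * PI) / INR n) + INR j * (2 * PI / INR n))
        by (rewrite S_INR; field; apply not_0_INR; lia).
      rewrite cis_add; ring.
Qed.

(** A finite Cauchy formula: with m + 1 equally spaced points every power of degree 1 to m averages
    to 0. *)
Lemma mean_value m a f r : deg_le m a f ->
  sumC (fun j => f (RtoC r * cis (INR j * (2 * PI / INR (S m))))%C) (S m)
    = (RtoC (INR (S m)) * f 0)%C.
Proof.
  destruct m; intros Hf.
  - simpl; rewrite !(Hf _); ring.
  - destruct Hf as [c [g [Hg Hf]]].
    rewrite (sumC_ext _ (fun j => c + RtoC r * (cis (INR j * (INR 1 * (2 * PI) / INR (S (S m)))) *
              g (RtoC r * cis (INR j * (2 * PI / INR (S (S m)))))))%C).
    + rewrite sumC_add, sumC_scal, sumC_const, (sumC_cis_deg_le m a) by (auto; lia).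
      rewrite Hf; ring.
    + intros j _. rewrite Hf.
      replace (INR 1 * (2 * PI)) with (2 * PI) by (simpl; ring). ring.
Qed.

Lemma mean_value_bound m a f r M : deg_le m a f -> 0 <= r ->
  (forall u, Cmod u = r -> Cmod (f u) <= M) -> Cmod (f 0) <= M.
Proof.
  intros Hf Hr H.
  assert (Hn : 0 < INR (S m)) by (apply lt_0_INR; lia).
  apply Rmult_le_reg_l with (INR (S m)); auto.
  rewrite <- (Rabs_pos_eq (INR (S m))) at 1 by lra.
  rewrite <- Cmod_R, <- Cmod_mult, <- (mean_value m a f r Hf).
  apply Cmod_sumC_le; intros j _. apply H.
  rewrite Cmod_mult, Cmod_cis, Cmod_R, Rabs_pos_eq; lra.
Qed.

(* The divided difference at h is the mean of its values on the circle of radius r/2 about h,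
   where |z| >= r/4. *)
Lemma cauchy_lipschitz m a f r M : deg_le m a f -> 0 < r ->
  (forall z, Cmod z < r -> Cmod (f z) <= M) ->
  forall h, Cmod h <= r / 4 -> Cmod (f h - f 0)%C <= 8 * M / r * Cmod h.
Proof.
  intros Hf Hr HM h Hh.
  assert (HM0 : 0 <= M).
  { apply Rle_trans with (Cmod (f 0)); [apply Cmod_ge_0|apply HM; rewrite Cmod_0; lra]. }
  destruct m.
  - rewrite !(Hf _). replace (a - a)%C with (RtoC 0) by ring. rewrite Cmod_0.
    apply Rmult_le_pos; [apply Rdiv_le_0_compat; lra|apply Cmod_ge_0].
  - destruct (deg_le_factor m 0 a f Hf) as [g [Hg E]].
    assert (Hgh : Cmod (g h) <= 8 * M / r).
    (* Recentring: g h becomes the value at 0 of the translated polynomial. *)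
    { replace h with (1 * 0 + h)%C by ring.
      apply (mean_value_bound m (a * 1 ^ m)%C (fun u => g (1 * u + h)%C) (r / 2));
        [now apply deg_le_comp_affine|lra|].
      intros u Hu. set (z := (1 * u + h)%C).
      assert (Hz1 : Cmod z < r).
      { unfold z; rewrite Cmult_1_l. generalize (Cmod_triangle u h); lra. }
      assert (Hz2 : r / 4 <= Cmod z).
      { replace u with (z + - h)%C in Hu by (unfold z; ring).
        generalize (Cmod_triangle z (- h)); rewrite Cmod_opp, Hu; lra. }
      assert (H2M : Cmod (z * g z)%C <= 2 * M).
      { replace (z * g z)%C with (f z + - f 0)%C by (rewrite (E z); ring).
        eapply Rle_trans; [apply Cmod_triangle|]. rewrite Cmod_opp.
        assert (H1 := HM z Hz1).
        assert (H2 : Cmod (f 0) <= M) by (apply HM; rewrite Cmod_0; lra). lra. }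
      rewrite Cmod_mult in H2M.
      apply Rmult_le_reg_l with (r / 4); [lra|].
      replace (r / 4 * (8 * M / r)) with (2 * M) by (field; lra).
      eapply Rle_trans; [|apply H2M].
      apply Rmult_le_compat_r; [apply Cmod_ge_0|auto]. }
    replace (f h - f 0)%C with (g h * h)%C by (rewrite (E h); ring).
    rewrite Cmod_mult. apply Rmult_le_compat_r; [apply Cmod_ge_0|auto].
Qed.

(* For m = n the weights are (-1)^j: the alternating sum of f over the extrema of T_n,
   each interior one counted twice. *)
Definition cos_sum (n m : nat) (f : C -> C) : C :=
  sumC (fun j => RtoC (cos (INR m * (INR j * (PI / INR n)))) *
                 f (RtoC (cos (INR j * (PI / INR n)))))%C (2 * n).

(** The sum of the weights is the real part of a vanishing sum over 2n-th roots of unity. *)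
Lemma cos_sum_const n m c f : (forall z, f z = c) -> (0 < m < 2 * n)%nat ->
  cos_sum n m f = 0.
Proof.
  intros Hf Hm; unfold cos_sum.
  rewrite (sumC_ext _ (fun j => c * RtoC (cos (INR m * (INR j * (PI / INR n)))))%C)
    by (intros; rewrite Hf; ring).
  rewrite sumC_scal.
  replace (sumC _ _) with (RtoC 0); [ring|].
  assert (E := sumC_cis_root (2 * n) m Hm).
  apply (f_equal Re) in E. rewrite Re_sumC in E.
  transitivity (RtoC (Re (RtoC 0))); [reflexivity|]. rewrite <- E.
  rewrite <- (sumC_RtoC (fun j => Re (cis (INR j * (INR m * (2 * PI) / INR (2 * n)))))).
  apply sumC_ext; intros j _. unfold cis, Re; cbn [fst]. do 2 f_equal.
  rewrite mult_INR; simpl (INR 2). field. apply not_0_INR; lia.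
Qed.

(** From 2 cos(mt) cos t = cos((m+1)t) + cos((m-1)t): a factor z splits the frequency m into its two
    neighbours, and the constant c contributes nothing. *)
Lemma cos_sum_mulX n m c f g : (forall z, f z = c + z * g z)%C -> (0 < m < 2 * n)%nat ->
  cos_sum n m f = ((cos_sum n (S m) g + cos_sum n (pred m) g) / 2)%C.
Proof.
  intros Hf Hm.
  assert (H0 := cos_sum_const n m c (fun _ => c) (fun _ => eq_refl) Hm).
  unfold cos_sum in *.
  rewrite (sumC_ext _ (fun j => RtoC (cos (INR m * (INR j * (PI / INR n)))) * c +
    (/ 2 * (RtoC (cos (INR (S m) * (INR j * (PI / INR n)))) * g (RtoC (cos (INR j * (PI / INR n))))) +
    / 2 * (RtoC (cos (INR (pred m) * (INR j * (PI / INR n)))) * g (RtoC (cos (INR j * (PI / INR n)))))))%C).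
  - rewrite !sumC_add, H0, !sumC_scal. field.
  - intros j _. rewrite Hf.
    set (t := INR j * (PI / INR n)).
    replace (INR (S m) * t) with (INR m * t + t) by (rewrite S_INR; ring).
    replace (INR (pred m) * t) with (INR m * t - t).
    2:{ destruct m; [lia|]. rewrite S_INR; simpl pred; ring. }
    rewrite cos_plus, cos_minus, RtoC_minus, RtoC_plus, !RtoC_mult.
    field.
Qed.

(** Discrete orthogonality: in k splittings the frequency stays strictly between 0 and 2n. *)
Lemma cos_sum_low n k : forall m a f, deg_le k a f -> (k < m)%nat -> (m + k < 2 * n)%nat ->
  cos_sum n m f = 0.
Proof.
  induction k; intros m a f Hf H1 H2.
  - apply cos_sum_const with a; [exact Hf|lia].
  - destruct Hf as [c [g [Hg Hf]]].
    rewrite (cos_sum_mulX n m c f g Hf), !(IHk _ a g Hg) by lia.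
    field.
Qed.

(** At each splitting only the lower neighbour survives, with a factor 1/2; at frequency 0 the
    constant a is summed 2n times. *)
Lemma cos_sum_diag n k : forall a f, deg_le k a f -> (k < n)%nat ->
  cos_sum n k f = (a * RtoC (INR (2 * n)) / 2 ^ k)%C.
Proof.
  assert (C2 : RtoC 2 <> 0) by (intros E; apply RtoC_inj in E; lra).
  induction k; intros a f Hf H.
  - unfold cos_sum. rewrite (sumC_ext _ (fun _ => a)).
    + rewrite sumC_const. simpl Cpow. field.
    + intros j _. rewrite (Hf _). simpl; rewrite Rmult_0_l, cos_0; ring.
  - destruct Hf as [c [g [Hg Hf]]].
    rewrite (cos_sum_mulX n (S k) c f g Hf) by lia. simpl Nat.pred.
    rewrite (cos_sum_low n k _ a g Hg), (IHk a g Hg) by lia.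
    rewrite Cpow_S. field. now apply Cpow_nz.
Qed.

(** At the nodes j PI / n the frequencies n + 1 and n - 1 coincide, so at the first splitting both
    neighbours survive. Hence the exponent n - 1 in place of n. *)
Lemma cos_sum_lead n a f : deg_le n a f -> (0 < n)%nat ->
  cos_sum n n f = (a * RtoC (INR (2 * n)) / 2 ^ (pred n))%C.
Proof.
  assert (C2 : RtoC 2 <> 0) by (intros E; apply RtoC_inj in E; lra).
  destruct n; intros Hf H; [lia|].
  destruct Hf as [c [g [Hg Hf]]].
  assert (E : cos_sum (S n) (S (S n)) g = cos_sum (S n) n g).
  { apply sumC_ext; intros j _. do 2 f_equal.
    assert (H0 : INR (S n) <> 0) by (apply not_0_INR; lia).
    replace (INR (S (S n)) * (INR j * (PI / INR (S n)))) with
      (- (INR n * (INR j * (PI / INR (S n)))) + 2 * INR j * PI)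
      by (rewrite (S_INR (S n)); replace (INR n) with (INR (S n) - 1) by (rewrite S_INR; ring);
          field; auto).
    now rewrite cos_period, cos_neg. }
  rewrite (cos_sum_mulX (S n) (S n) c f g Hf) by lia.
  simpl pred. rewrite E, (cos_sum_diag (S n) n a g Hg) by lia.
  field. now apply Cpow_nz.
Qed.

(** * Chebyshev polynomials *)

Fixpoint cheb (n : nat) (z : C) : C :=
  match n with
  | O => RtoC 1
  | S m => match m with O => z | S k => (2 * z * cheb m z - cheb k z)%C end
  end.

Lemma cheb_deg_le n : deg_le (S n) (2 ^ n) (cheb (S n)).
Proof.
  (* The recurrence needs two consecutive degrees. The lower leading coefficient is existential
     because T_0 breaks the pattern 2^(n-1). *)
  assert (H : (exists a, deg_le n a (cheb n)) /\ deg_le (S n) (2 ^ n)%C (cheb (S n))); [|tauto].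
  induction n as [|n [[a H1] H2]]; split.
  - exists 1; simpl; auto.
  - exists (RtoC 0), (fun _ => RtoC 1); split; simpl; auto. intros; ring.
  - eauto.
  - replace (2 ^ S n)%C with (2 * 2 ^ n + (- (1)) * 0)%C by (rewrite Cpow_S; ring).
    apply deg_le_ext with (fun z => 2 * (z * cheb (S n) z) + (- (1)) * cheb n z)%C.
    + apply deg_le_add; apply deg_le_scal; [now apply deg_le_mulX|].
      apply deg_le_weaken with n a; auto.
    + intros z; simpl; ring.
Qed.

Lemma ccos_add_sub u v : (ccos (u + v) + ccos (u - v) = 2 * ccos u * ccos v)%C.
Proof.
  destruct u as [x y], v as [s t].
  unfold ccos, Cminus, Cplus, Copp, Cmult, RtoC; simpl.
  change (x + - s) with (x - s).
  rewrite cos_plus, sin_plus, cos_minus, sin_minus.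
  unfold cosh, sinh. rewrite !Ropp_plus_distr, !Ropp_involutive, !exp_plus.
  f_equal; field.
Qed.

(** Both sides obey the same three-term recurrence in n, so two consecutive cases are carried
    together. *)
Lemma cheb_ccos n w : cheb n (ccos w) = ccos (RtoC (INR n) * w).
Proof.
  assert (H : cheb n (ccos w) = ccos (RtoC (INR n) * w)%C /\
    cheb (S n) (ccos w) = ccos (RtoC (INR (S n)) * w)%C); [|tauto].
  induction n as [|n [H1 H2]].
  - split; simpl cheb.
    + replace (RtoC (INR 0) * w)%C with (RtoC 0) by (simpl; ring).
      unfold ccos; simpl. rewrite cos_0, sin_0, cosh_0.
      unfold RtoC; f_equal; ring.
    + f_equal; simpl; ring.
  - split; auto.
    change (cheb (S (S n)) (ccos w)) with (2 * ccos w * cheb (S n) (ccos w) - cheb n (ccos w))%C.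
    rewrite H1, H2.
    assert (E := ccos_add_sub (RtoC (INR (S n)) * w) w).
    replace (RtoC (INR (S n)) * w + w)%C with (RtoC (INR (S (S n))) * w)%C in E
      by (rewrite (S_INR (S n)), RtoC_plus; ring).
    replace (RtoC (INR (S n)) * w - w)%C with (RtoC (INR n) * w)%C in E
      by (rewrite S_INR, RtoC_plus; ring).
    replace (ccos (RtoC (INR (S (S n))) * w)) with
      (ccos (RtoC (INR (S (S n))) * w) + ccos (RtoC (INR n) * w) - ccos (RtoC (INR n) * w))%C by ring.
    rewrite E; ring.
Qed.

Lemma ccos_RtoC t : ccos (RtoC t) = RtoC (cos t).
Proof.
  unfold ccos; simpl. rewrite cosh_0, sinh_0. unfold RtoC; f_equal; ring.
Qed.

Lemma cheb_cos n t : cheb n (RtoC (cos t)) = RtoC (cos (INR n * t)).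
Proof.
  now rewrite <- ccos_RtoC, cheb_ccos, <- RtoC_mult, ccos_RtoC.
Qed.

Definition unit_segment (z : C) : Prop := exists t, -1 <= t <= 1 /\ z = RtoC t.

Lemma unit_segment_cos t : unit_segment (RtoC (cos t)).
Proof. exists (cos t); split; auto. apply COS_bound. Qed.

Lemma cheb_unit_segment n z : unit_segment z -> Cmod (cheb n z) <= 1.
Proof.
  intros [t [Ht ->]].
  rewrite <- (cos_acos t Ht), cheb_cos, Cmod_R. apply Rabs_le, COS_bound.
Qed.

(* s = 1/2, k = n gives the zeros of T_n; s = 0, k = n + 1 gives its extrema. *)
Definition cos_nodes (s : R) (n k : nat) : list C :=
  map (fun j => RtoC (cos ((INR j + s) * (PI / INR n)))) (seq 0 k).

Lemma cos_nodes_length s n k : length (cos_nodes s n k) = k.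
Proof. unfold cos_nodes; now rewrite length_map, length_seq. Qed.

(** The condition on k puts the last angle (k - 1 + s) PI / n at most at PI, and the cosine is
    injective on [0, PI]. *)
Lemma cos_nodes_NoDup s n k : (0 < n)%nat -> 0 <= s -> INR k + s <= INR n + 1 ->
  NoDup (cos_nodes s n k).
Proof.
  intros Hn Hs Hk. apply lt_0_INR in Hn. assert (HPI := PI_RGT_0).
  assert (Hp : 0 < PI / INR n) by (apply Rdiv_lt_0_compat; lra).
  apply NoDup_map_NoDup_ForallPairs; [|apply seq_NoDup].
  assert (Hb : forall i, In i (seq 0 k) -> 0 <= (INR i + s) * (PI / INR n) <= PI).
  { intros i Hi. apply in_seq in Hi.
    assert (H1 : INR (S i) <= INR k) by (apply le_INR; lia).
    rewrite S_INR in H1. assert (H0 := pos_INR i).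
    split; [apply Rmult_le_pos; lra|].
    replace PI with (INR n * (PI / INR n)) at 2 by (field; lra).
    apply Rmult_le_compat_r; lra. }
  intros i j Hi Hj E. apply RtoC_inj, cos_inj in E; auto.
  apply Rmult_eq_reg_r in E; [|lra]. apply INR_eq; lra.
Qed.

(** The angles (j + 1/2) PI / (n + 1) give n + 1 distinct zeros, which is the full degree. *)
Lemma cheb_factor n z :
  cheb (S n) z = (2 ^ n * prodC (fun x => z - x) (cos_nodes (1/2) (S n) (S n)))%C.
Proof.
  apply deg_le_split_roots with (S n).
  - apply cheb_deg_le.
  - apply cos_nodes_length.
  - apply cos_nodes_NoDup; [lia|lra|lra].
  - intros r Hr. apply in_map_iff in Hr. destruct Hr as [j [<- _]].
    rewrite cheb_cos. f_equal.
    apply cos_eq_0_1. exists (Z.of_nat j). rewrite <- INR_IZR_INZ.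
    field. apply not_0_INR; lia.
Qed.

Lemma Cmod_prodC_opp {A} (f g : A -> C) l :
  Cmod (prodC (fun x => f x - g x)%C l) = Cmod (prodC (fun x => g x - f x)%C l).
Proof.
  induction l; simpl; auto.
  rewrite !Cmod_mult, IHl. f_equal.
  rewrite <- Cmod_opp. f_equal; ring.
Qed.

Lemma prodC_at_root r l : In r l -> prodC (fun s => r - s)%C l = 0.
Proof.
  induction l; simpl; [tauto|]. intros [->|H]; [|rewrite IHl by auto]; ring.
Qed.

Lemma Cmod_RtoC_pow2 n : Cmod (RtoC 2 ^ n)%C = 2 ^ n.
Proof. rewrite Cmod_pow, Cmod_R, Rabs_pos_eq; lra. Qed.

(* Write q - y = a prod (z - z_i); all z_i lie in [-1,1], and the
   product of (x - z_i) over the zeros x of T_(m+1) is T_(m+1)(z_i)/2^m up to sign. *)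
Lemma product_at_cheb_zeros_le d a q m y : deg_le d a q -> a <> 0 ->
  (0 < d)%nat -> (forall z, unit_segment (q z) -> unit_segment z) -> unit_segment y ->
  Cmod (prodC (fun x => q x - y)%C (cos_nodes (1/2) (S m) (S m)))
    <= Cmod a ^ S m * (1 / 2 ^ m) ^ d.
Proof.
  intros Hq Ha Hd Hinv Hy.
  assert (Hqy : deg_le d a (fun z => q z - y)%C).
  { replace a with (a + 0)%C by ring.
    apply (deg_le_add d a 0 q (fun _ => (- y)%C)); auto.
    apply deg_le_weaken with O (- y)%C; simpl; auto. }
  destruct (deg_le_split d a _ Hqy Ha) as [l [Hl E]].
  set (xs := cos_nodes (1/2) (S m) (S m)).
  assert (Hlen : length xs = S m) by apply cos_nodes_length.
  rewrite (prodC_ext _ (fun x => a * prodC (fun r => x - r) l)%C) by (intros; apply E).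
  rewrite prodC_scal, prodC_swap, Hlen, Cmod_mult, Cmod_pow, <- Hl.
  apply Rmult_le_compat_l; [apply pow_le, Cmod_ge_0|].
  apply Cmod_prodC_le; intros r Hr.
  assert (Hur : unit_segment r).
  { apply Hinv. replace (q r) with y; auto.
    replace (q r) with (q r - y + y)%C by ring. rewrite E, prodC_at_root by auto. ring. }
  assert (Hc := cheb_unit_segment (S m) r Hur).
  rewrite cheb_factor, Cmod_mult, Cmod_RtoC_pow2 in Hc. fold xs in Hc.
  assert (H2 : 0 < 2 ^ m) by (apply pow_lt; lra).
  rewrite (Cmod_prodC_opp (fun x => x) (fun _ => r)).
  apply Rmult_le_reg_l with (2 ^ m); auto.
  replace (2 ^ m * (1 / 2 ^ m)) with 1 by (field; lra). exact Hc.
Qed.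

(** * The leading coefficient and the equality case *)

Lemma cos_sum_bound n f M : (forall z, unit_segment z -> Cmod (f z) <= M) ->
  Cmod (cos_sum n n f) <= INR (2 * n) * M.
Proof.
  intros H. apply Cmod_sumC_le; intros j _.
  rewrite Cmod_mult, Cmod_R.
  assert (H1 := H _ (unit_segment_cos (INR j * (PI / INR n)))).
  assert (H2 := Cmod_ge_0 (f (cos (INR j * (PI / INR n))))).
  assert (H3 : Rabs (cos (INR n * (INR j * (PI / INR n)))) <= 1)
    by apply Rabs_le, COS_bound.
  assert (H4 := Rabs_pos (cos (INR n * (INR j * (PI / INR n))))). nra.
Qed.

(** In effect, logarithmic capacity is monotone. The monic [G] with zeros q(x) has [cos_sum] equal
    to 2(m+1)/2^m, while [product_at_cheb_zeros_le] bounds [G] on [-1,1] from above. This leaves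
    (2^e)^m <= |a|^(m+1) for every m, which excludes |a| < 2^e for large m. *)
Lemma lead_ge_of_preimage_unit_segment e a q : deg_le (S e) a q -> a <> 0 ->
  (forall z, unit_segment (q z) -> unit_segment z) -> 2 ^ e <= Cmod a.
Proof.
  intros Hq Ha Hinv.
  assert (key : forall m, (2 ^ e) ^ m <= Cmod a ^ S m).
  { intros m.
    set (xs := cos_nodes (1/2) (S m) (S m)).
    set (G := fun y => prodC (fun r => y - r)%C (map q xs)).
    assert (HG : deg_le (S m) 1 G).
    { replace (S m) with (length (map q xs)); [apply deg_le_prod|].
      rewrite length_map; apply cos_nodes_length. }
    assert (Hmap : forall y l, prodC (fun r => y - r)%C (map q l) = prodC (fun x => y - q x)%C l).
    { intros y l; induction l; simpl; auto. now rewrite IHl. }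
    assert (HB := cos_sum_bound (S m) G (Cmod a ^ S m * (1 / 2 ^ m) ^ S e)).
    rewrite (cos_sum_lead (S m) 1 G HG) in HB by lia.
    assert (H2 : 0 < 2 ^ m) by (apply pow_lt; lra).
    assert (HN : 0 < INR (2 * S m)) by (apply lt_0_INR; lia).
    simpl Nat.pred in HB.
    rewrite Cmod_div, Cmod_mult, Cmod_1, Cmod_R, Cmod_RtoC_pow2, Rabs_pos_eq in HB;
      [|lra|apply Cpow_nz; intros E; apply RtoC_inj in E; lra].
    assert (HB' : 1 * INR (2 * S m) / 2 ^ m <= INR (2 * S m) * (Cmod a ^ S m * (1 / 2 ^ m) ^ S e)).
    { apply HB. intros z Hz. unfold G. rewrite Hmap, Cmod_prodC_opp.
      now apply product_at_cheb_zeros_le; [| | lia | |]. }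
    rewrite <- tech_pow_Rmult with (n := e) in HB'.
    assert (He : 0 < (2 ^ e) ^ m) by (apply pow_lt, pow_lt; lra).
    assert (Hp : (1 / 2 ^ m) ^ e = / (2 ^ e) ^ m).
    { unfold Rdiv; rewrite Rmult_1_l, pow_inv, <- !pow_mult. now rewrite Nat.mul_comm. }
    rewrite Hp in HB'.
    (* The common positive factor of both sides of [HB'], which is to be cancelled. *)
    apply Rmult_le_reg_l with (INR (2 * S m) * (1 / 2 ^ m * / (2 ^ e) ^ m)).
    - apply Rmult_lt_0_compat; auto. apply Rmult_lt_0_compat.
      + apply Rdiv_lt_0_compat; lra.
      + now apply Rinv_0_lt_compat.
    - replace (INR (2 * S m) * (1 / 2 ^ m * / (2 ^ e) ^ m) * (2 ^ e) ^ m)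
        with (1 * INR (2 * S m) / 2 ^ m) by (field; lra).
      eapply Rle_trans; [apply HB'|]. right; ring. }
  destruct (Rle_or_lt (2 ^ e) (Cmod a)) as [H|H]; auto. exfalso.
  assert (HA : 0 < 2 ^ e) by (apply pow_lt; lra).
  assert (H0 := Cmod_ge_0 a).
  (* The threshold 2^(-e) turns the estimate at exponent N + 1 into |a|^(N+1) < (2^e)^N, contrary to
     [key N]. *)
  destruct (pow_lt_1_zero (Cmod a / 2 ^ e)) with (y := / 2 ^ e) as [N HN].
  - rewrite Rabs_pos_eq; [|apply Rdiv_le_0_compat; lra].
    apply Rmult_lt_reg_r with (2 ^ e); auto.
    unfold Rdiv; rewrite Rmult_assoc, Rinv_l; lra.
  - now apply Rinv_0_lt_compat.
  - assert (K := key N). assert (L := HN (S N) (Nat.le_succ_diag_r N)).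
    assert (HP : 0 < (2 ^ e) ^ N) by (apply pow_lt; auto).
    assert (HP' : 0 < (2 ^ e) ^ S N) by (apply pow_lt; auto).
    rewrite Rabs_pos_eq in L by (apply pow_le, Rdiv_le_0_compat; lra).
    unfold Rdiv in L; rewrite Rpow_mult_distr, pow_inv in L.
    apply Rmult_lt_compat_r with (r := (2 ^ e) ^ S N) in L; auto.
    rewrite Rmult_assoc, Rinv_l, Rmult_1_r in L by lra.
    simpl ((2 ^ e) ^ S N) in L.
    rewrite <- Rmult_assoc, Rinv_l, Rmult_1_l in L by lra. lra.
Qed.

(** Equality case of the triangle inequality. The one-sided version [Hup] is applied to h or to -h,
    according to the sign of the sum. *)
Lemma sum_extremal n : forall h : nat -> R, (forall j, -1 <= h j <= 1) ->
  INR n <= Cmod (sumC (fun j => RtoC (h j)) n) ->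
  exists e, (e = 1 \/ e = -1) /\ forall j, (j < n)%nat -> h j = e.
Proof.
  intros h Hh H.
  assert (Hup : forall (g : nat -> R) k, (forall j, g j <= 1) ->
     Re (sumC (fun j => RtoC (g j)) k) <= INR k /\
     (INR k <= Re (sumC (fun j => RtoC (g j)) k) -> forall j, (j < k)%nat -> g j = 1)).
  { intros g k Hg; induction k as [|k [I1 I2]].
    - simpl; split; [lra|intros; lia].
    - rewrite S_INR. simpl sumC. rewrite re_plus, re_RtoC. specialize (Hg k) as Hk.
      split; [lra|]. intros HS j Hj.
      destruct (Nat.eq_dec j k) as [->|Hne]; [lra|]. apply I2; [lra|lia]. }
  rewrite sumC_RtoC, Cmod_R in H.
  unfold Rabs in H. destruct (Rcase_abs _) as [Hneg|Hpos].
  - exists (-1); split; auto. intros j Hj.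
    assert (E : - h j = 1); [|lra].
    apply (proj2 (Hup (fun i => - h i) n (fun i => ltac:(specialize (Hh i); lra)))); auto.
    rewrite (sumC_ext _ (fun i => - (1) * RtoC (h i))%C) by (intros; rewrite RtoC_opp; ring).
    rewrite sumC_scal, sumC_RtoC. simpl; simpl in H. lra.
  - exists 1; split; auto. apply (proj2 (Hup h n (fun i => proj2 (Hh i)))); lra.
Qed.

(** Backward invariance bounds the leading coefficient from below; forward invariance bounds the
    values at the extrema of T_d. The two bounds meet in equality. *)
Theorem cheb_of_invariant_unit_segment d a q : deg_le d a q -> a <> 0 -> (0 < d)%nat ->
  (forall z, unit_segment (q z) <-> unit_segment z) ->
  (forall z, q z = cheb d z) \/ (forall z, q z = Copp (cheb d z)).
Proof.
  intros Hq Ha Hd Hinv. destruct d as [|e]; [lia|].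
  assert (Hlead := lead_ge_of_preimage_unit_segment e a q Hq Ha (fun z => proj1 (Hinv z))).
  assert (Hs := cos_sum_lead (S e) a q Hq Hd). simpl Nat.pred in Hs.
  set (t j := INR j * (PI / INR (S e))).
  assert (Hreal : forall j, exists s, -1 <= s <= 1 /\ q (RtoC (cos (t j))) = RtoC s).
  { intros j. apply Hinv, unit_segment_cos. }
  set (h j := cos (INR (S e) * t j) * Re (q (RtoC (cos (t j))))).
  assert (Hqr : forall j, q (RtoC (cos (t j))) = RtoC (Re (q (RtoC (cos (t j)))))).
  { intros j. destruct (Hreal j) as [s [_ ->]]. reflexivity. }
  assert (Hh : forall j, -1 <= h j <= 1).
  { intros j; unfold h. destruct (Hreal j) as [s [Hs' ->]]. rewrite re_RtoC.
    assert (B := COS_bound (INR (S e) * t j)). nra. }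
  (* The sum of the h j has modulus 2d |a| / 2^e, which is at least its number 2d of terms. *)
  destruct (sum_extremal (2 * S e) h Hh) as [s [Hsign Heq]].
  { replace (sumC (fun j => RtoC (h j)) (2 * S e)) with (cos_sum (S e) (S e) q).
    2:{ apply sumC_ext; intros j _. unfold h. fold (t j). rewrite RtoC_mult.
        now rewrite <- Hqr. }
    rewrite Hs. assert (H2 : 0 < 2 ^ e) by (apply pow_lt; lra).
    rewrite Cmod_div, Cmod_mult, Cmod_R, Cmod_RtoC_pow2, Rabs_pos_eq;
      [|apply pos_INR|apply Cpow_nz; intros E; apply RtoC_inj in E; lra].
    apply Rmult_le_reg_r with (2 ^ e); auto.
    unfold Rdiv; rewrite Rmult_assoc, Rinv_l, Rmult_1_r by lra.
    rewrite Rmult_comm. apply Rmult_le_compat_r; auto using pos_INR. }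
  (* The difference q - s T_d has degree at most d and vanishes at the d + 1 extrema of T_d. *)
  assert (Hdiff : deg_le (S e) (a + (- RtoC s) * 2 ^ e)%C (fun z => q z + (- RtoC s) * cheb (S e) z)%C).
  { apply deg_le_add, deg_le_scal, cheb_deg_le; auto. }
  assert (Hzero : forall z, (q z + (- RtoC s) * cheb (S e) z)%C = 0).
  { apply (deg_le_eq0 _ _ _ (cos_nodes 0 (S e) (S (S e))) Hdiff).
    - apply cos_nodes_length.
    - apply cos_nodes_NoDup; [lia|lra|rewrite S_INR; lra].
    - intros r Hr. apply in_map_iff in Hr. destruct Hr as [j [<- Hj]].
      apply in_seq in Hj. rewrite Rplus_0_r. fold (t j).
      rewrite cheb_cos, Hqr, <- RtoC_opp, <- RtoC_mult, <- RtoC_plus. f_equal.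
      assert (Hj' := Heq j ltac:(lia)). unfold h in Hj'.
      (* The weight c is cos(j PI), so c^2 = 1, and c y = s turns into y = s c. *)
      assert (Hsq : cos (INR (S e) * t j) * cos (INR (S e) * t j) = 1).
      { replace (INR (S e) * t j) with (INR j * PI)
          by (unfold t; field; apply not_0_INR; lia).
        clear. induction j; [simpl; rewrite Rmult_0_l, cos_0; ring|].
        rewrite S_INR, Rmult_plus_distr_r, Rmult_1_l, neg_cos; lra. }
      rewrite <- Hj'.
      set (c := cos (INR (S e) * t j)) in *. set (y := Re _).
      transitivity (y * (1 - c * c)); [ring|rewrite Hsq; ring]. }
  destruct Hsign as [-> | ->]; [left|right]; intros z; specialize (Hzero z).
  - replace (q z) with (q z + - RtoC 1 * cheb (S e) z + cheb (S e) z)%C by ring.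
    rewrite Hzero; ring.
  - replace (- RtoC (-1))%C with (RtoC 1) in Hzero by (rewrite <- RtoC_opp; f_equal; lra).
    replace (q z) with (q z + 1 * cheb (S e) z - cheb (S e) z)%C by ring.
    rewrite Hzero; ring.
Qed.

(** * Equicontinuity of the iterates *)

Lemma sqrt_1p_ge1 x : 1 <= sqrt (1 + x ^ 2).
Proof.
  rewrite <- sqrt_1 at 1. apply sqrt_le_1_alt. assert (H := pow2_ge_0 x); lra.
Qed.

Lemma chordal_Some z w : chordal (Some z) (Some w) =
  2 * Cmod (z - w) / (sqrt (1 + Cmod z ^ 2) * sqrt (1 + Cmod w ^ 2)).
Proof.
  simpl chordal. rewrite sqrt_mult_alt; auto. assert (H := pow2_ge_0 (Cmod z)); lra.
Qed.

Lemma chordal_le z w : chordal (Some z) (Some w) <= 2 * Cmod (z - w).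
Proof.
  rewrite chordal_Some.
  assert (H1 := sqrt_1p_ge1 (Cmod z)). assert (H2 := sqrt_1p_ge1 (Cmod w)).
  assert (H3 := Cmod_ge_0 (z - w)%C).
  set (A := sqrt (1 + Cmod z ^ 2)) in *. set (B := sqrt (1 + Cmod w ^ 2)) in *.
  assert (HAB : 1 <= A * B) by nra.
  apply Rmult_le_reg_r with (A * B); [lra|].
  unfold Rdiv; rewrite Rmult_assoc, Rinv_l by lra. nra.
Qed.

Lemma Cmod_sub_sym (z w : C) : Cmod (z - w) = Cmod (w - z).
Proof. rewrite <- Cmod_opp. f_equal; ring. Qed.

(** On nonnegative reals sqrt(1 + x^2) is increasing and 1-Lipschitz. *)
Lemma sqrt_1p_le (x a t : R) : 0 <= a -> 0 <= t -> 0 <= x <= a + t ->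
  sqrt (1 + x ^ 2) <= sqrt (1 + a ^ 2) + t.
Proof.
  intros Ha Ht Hx.
  assert (H1 := sqrt_1p_ge1 a).
  assert (HS : sqrt (1 + a ^ 2) * sqrt (1 + a ^ 2) = 1 + a ^ 2)
    by (apply sqrt_sqrt; nra).
  set (S := sqrt (1 + a ^ 2)) in *.
  rewrite <- (sqrt_square (S + t)) by lra. apply sqrt_le_1_alt.
  assert (a <= S) by (destruct (Rle_or_lt a S); auto; nra). nra.
Qed.

Lemma chordal_near (z : C) r : 0 < r -> exists delta, 0 < delta /\
  forall y, chordal (Some z) y < delta -> exists w, y = Some w /\ Cmod (w - z) < r.
Proof.
  intros Hr. assert (HA := sqrt_1p_ge1 (Cmod z)).
  set (A := sqrt (1 + Cmod z ^ 2)) in *.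
  (* Infinity is at distance 2/A, so 1/A excludes it. For a finite w at chordal distance c and
     Euclidean distance t, 2t = cAB <= cA^2 + cAt; the first bound gives cA < 1, the second cA^2 <
     r, hence t < r. *)
  exists (Rmin (/ A) (r / (A * A))). split.
  { apply Rmin_pos; [apply Rinv_0_lt_compat; lra|apply Rdiv_lt_0_compat; nra]. }
  intros [w|] Hy.
  - exists w; split; auto.
    assert (H1 := Rlt_le_trans _ _ _ Hy (Rmin_l _ _)).
    assert (H2 := Rlt_le_trans _ _ _ Hy (Rmin_r _ _)). clear Hy.
    assert (Ht := Cmod_ge_0 (w - z)%C).
    assert (HB : sqrt (1 + Cmod w ^ 2) <= A + Cmod (w - z)).
    { apply sqrt_1p_le; auto using Cmod_ge_0. split; [apply Cmod_ge_0|].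
      eapply Rle_trans; [|apply Cmod_triangle]. right; f_equal; ring. }
    assert (HB1 := sqrt_1p_ge1 (Cmod w)).
    rewrite chordal_Some, Cmod_sub_sym in H1, H2. fold A in H1, H2.
    set (B := sqrt (1 + Cmod w ^ 2)) in *. set (t := Cmod (w - z)) in *.
    set (c := 2 * t / (A * B)) in *.
    assert (Hc : c * (A * B) = 2 * t) by (unfold c; field; lra).
    assert (Hc0 : 0 <= c) by (apply Rdiv_le_0_compat; nra).
    assert (HcA : c * A < 1).
    { apply Rmult_lt_compat_r with (r := A) in H1; [|lra]. rewrite Rinv_l in H1; lra. }
    assert (HcAA : c * (A * A) < r).
    { apply Rmult_lt_compat_r with (r := A * A) in H2; [|nra].
      unfold Rdiv in H2; rewrite Rmult_assoc, Rinv_l in H2; nra. }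
    assert (HAB : c * (A * B) <= c * A * (A + t)).
    { rewrite <- Rmult_assoc. apply Rmult_le_compat_l; [nra|auto]. }
    nra.
  - exfalso. simpl in Hy.
    assert (H1 := Rlt_le_trans _ _ _ Hy (Rmin_l _ _)).
    change (sqrt (1 + Cmod z * (Cmod z * 1))) with A in H1.
    assert (0 < / A) by (apply Rinv_0_lt_compat; lra). unfold Rdiv in H1; lra.
Qed.

Lemma Fatou_open F z : Fatou F (Some z) ->
  exists r, 0 < r /\ forall w, Cmod (w - z) < r -> Fatou F (Some w).
Proof.
  (* Two Euclidean steps of r/4 make r/2, and the chordal distance at most doubles it. *)
  intros [r [Hr H]]. exists (r / 4); split; [lra|]. intros w Hw.
  destruct (chordal_near w (r / 4)) as [delta [Hd Hn]]; [lra|].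
  exists delta; split; auto. intros y Hy.
  destruct (Hn y Hy) as [v [-> Hv]]. apply H.
  eapply Rle_lt_trans; [apply chordal_le|].
  rewrite Cmod_sub_sym. replace (v - z)%C with ((v - w) + (w - z))%C by ring.
  generalize (Cmod_triangle (v - w) (w - z)); lra.
Qed.

Lemma Fatou_infinity F : Fatou F None ->
  exists R, forall w, R < Cmod w -> Fatou F (Some w).
Proof.
  (* A point of modulus above 2/r is within r of infinity; the extra 1 leaves room for a unit disc
     about w. *)
  intros [r [Hr H]]. exists (2 / r + 1). intros w Hw.
  destruct (chordal_near w 1) as [delta [Hd Hn]]; [lra|].
  exists delta; split; auto. intros y Hy.
  destruct (Hn y Hy) as [v [-> Hv]]. apply H. simpl.
  assert (Hv' : 2 / r < Cmod v).
  { rewrite Cmod_sub_sym in Hv.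
    replace w with (w - v + v)%C in Hw by ring.
    generalize (Cmod_triangle (w - v) v); lra. }
  assert (H2 : 0 < 2 / r) by (apply Rdiv_lt_0_compat; lra).
  assert (Hs : Cmod v <= sqrt (1 + Cmod v * (Cmod v * 1))).
  { rewrite <- (sqrt_square (Cmod v)) at 1 by lra. apply sqrt_le_1_alt; lra. }
  apply Rmult_lt_reg_r with (sqrt (1 + Cmod v * (Cmod v * 1))); [lra|].
  unfold Rdiv at 1; rewrite Rmult_assoc, Rinv_l by lra.
  apply Rlt_le_trans with (r * Cmod v).
  - replace (2 * 1) with (r * (2 / r)) by (field; lra). apply Rmult_lt_compat_l; auto.
  - apply Rmult_le_compat_l; lra.
Qed.

Lemma iter_sext n p z : Nat.iter n (sext p) (Some z) = Some (Nat.iter n p z).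
Proof. induction n; simpl; auto. now rewrite IHn. Qed.

(** An elementary case of Montel's theorem: on discs of radius r/2 about points near z0 the Cauchy
    estimate gives all iterates the same Lipschitz constant [L]. *)
Lemma Fatou_of_bounded d a p z0 r M : deg_le d a p -> 0 < r ->
  (forall n z, Cmod (z - z0) < r -> Cmod (Nat.iter n p z) <= M) ->
  Fatou (sext p) (Some z0).
Proof.
  intros Hp Hr HM.
  assert (HM0 : 0 <= M).
  { apply Rle_trans with (Cmod (Nat.iter 0 p z0)); [apply Cmod_ge_0|apply HM].
    replace (z0 - z0)%C with (RtoC 0) by ring. now rewrite Cmod_0. }
  destruct (chordal_near z0 (r / 2)) as [d0 [Hd0 Hn0]]; [lra|].
  exists d0; split; auto. intros y Hy. destruct (Hn0 y Hy) as [w [-> Hw]].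
  set (L := 8 * M / (r / 2)).
  assert (HL : 0 <= L) by (apply Rdiv_le_0_compat; lra).
  intros eps Heps.
  (* [cauchy_lipschitz] on a disc of radius r/2 is valid up to r/8; the second bound makes 2L |v -
     w| < eps. *)
  set (rad := Rmin (r / 8) (eps / (2 * (L + 1)))).
  assert (Hrad : 0 < rad)
    by (apply Rmin_pos; [lra|apply Rdiv_lt_0_compat; lra]).
  destruct (chordal_near w rad Hrad) as [delta [Hd Hn]].
  exists delta; split; auto. intros y' Hy' n. destruct (Hn y' Hy') as [v [-> Hv]].
  rewrite !iter_sext.
  eapply Rle_lt_trans; [apply chordal_le|]. rewrite Cmod_sub_sym.
  destruct (deg_le_iter d a p n Hp) as [m [b Hm]].
  assert (Hlip := cauchy_lipschitz m (b * 1 ^ m)%C (fun u => Nat.iter n p (1 * u + w)%C)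
    (r / 2) M (deg_le_comp_affine m 1 w b _ Hm) ltac:(lra)).
  assert (Hv1 := Rlt_le_trans _ _ _ Hv (Rmin_l _ _)).
  assert (Hv2 := Rlt_le_trans _ _ _ Hv (Rmin_r _ _)).
  specialize (fun H => Hlip H (v - w)%C ltac:(lra)).
  cbv beta in Hlip.
  replace (1 * (v - w) + w)%C with v in Hlip by ring.
  replace (1 * 0 + w)%C with w in Hlip by ring.
  fold L in Hlip.
  eapply Rle_lt_trans.
  { apply Rmult_le_compat_l; [lra|]. apply Hlip.
    intros u Hu. apply HM.
    replace (1 * u + w - z0)%C with (u + (w - z0))%C by ring.
    generalize (Cmod_triangle u (w - z0)); lra. }
  assert (H3 : (L + 1) * Cmod (v - w) < eps / 2).
  { replace (eps / 2) with ((L + 1) * (eps / (2 * (L + 1)))) by (field; lra).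
    apply Rmult_lt_compat_l; lra. }
  assert (H4 := Cmod_ge_0 (v - w)%C). lra.
Qed.

(** * Escaping orbits and points of the Julia set *)

Lemma chordal_sym x y : chordal x y = chordal y x.
Proof.
  destruct x as [z|], y as [w|]; auto.
  rewrite !chordal_Some, Cmod_sub_sym. f_equal; ring.
Qed.

(** Since |w| > 2R + 1, 2|z - w| >= 2(|w| - R) >= 1 + |w| >= sqrt(1 + |w|^2), which cancels the
    factor of w in the denominator. *)
Lemma chordal_separated (z w : C) R : Cmod z <= R -> 2 * R + 1 < Cmod w ->
  / sqrt (1 + R ^ 2) <= chordal (Some z) (Some w).
Proof.
  intros Hz Hw. rewrite chordal_Some.
  assert (Hz0 := Cmod_ge_0 z).
  assert (HA := sqrt_1p_ge1 (Cmod z)). assert (HB := sqrt_1p_ge1 (Cmod w)).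
  assert (HAS : sqrt (1 + Cmod z ^ 2) <= sqrt (1 + R ^ 2)) by (apply sqrt_le_1_alt; nra).
  assert (HBw : sqrt (1 + Cmod w ^ 2) <= sqrt (1 + 0 ^ 2) + Cmod w)
    by (apply sqrt_1p_le; lra).
  replace (1 + 0 ^ 2) with 1 in HBw by ring. rewrite sqrt_1 in HBw.
  assert (Hd : Cmod w - Cmod z <= Cmod (z - w)).
  { rewrite Cmod_sub_sym. replace w with (w - z + z)%C at 1 by ring.
    generalize (Cmod_triangle (w - z) z); lra. }
  set (A := sqrt (1 + Cmod z ^ 2)) in *. set (B := sqrt (1 + Cmod w ^ 2)) in *.
  set (S := sqrt (1 + R ^ 2)) in *.
  apply Rmult_le_reg_r with (A * B); [nra|].
  unfold Rdiv; rewrite (Rmult_assoc _ (/ (A * B))), Rinv_l by nra.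
  apply Rmult_le_reg_l with S; [lra|].
  rewrite <- Rmult_assoc, Rinv_r by lra.
  apply Rle_trans with (S * B); [nra|]. apply Rmult_le_compat_l; lra.
Qed.

(** Whichever kind of orbit x has, points of the other kind lie arbitrarily near and are at some
    time separated from it by a fixed chordal distance. *)
Lemma not_Fatou_of_dichotomy p x R :
  (forall eta, 0 < eta -> exists s, Cmod (x - s) < eta /\
     forall n, Cmod (Nat.iter n p s) <= R) ->
  (forall eta, 0 < eta -> exists s, Cmod (x - s) < eta /\
     forall B, exists n, B < Cmod (Nat.iter n p s)) ->
  (forall s, (forall n, Cmod (Nat.iter n p s) <= R) \/
             forall B, exists n, B < Cmod (Nat.iter n p s)) ->
  ~ Fatou (sext p) (Some x).
Proof.
  intros Hbd Hesc Hdich [r [Hr H]].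
  assert (Heq : equicont_at (sext p) (Some x)).
  { apply H. rewrite chordal_Some. replace (x - x)%C with (RtoC 0) by ring.
    rewrite Cmod_0. unfold Rdiv; rewrite Rmult_0_r, Rmult_0_l; auto. }
  destruct (Heq (/ sqrt (1 + R ^ 2))) as [delta [Hd Hn]].
  { apply Rinv_0_lt_compat. assert (A := sqrt_1p_ge1 R); lra. }
  assert (Hclose : forall s n, Cmod (x - s) < delta / 2 ->
    chordal (Some (Nat.iter n p x)) (Some (Nat.iter n p s)) < / sqrt (1 + R ^ 2)).
  { intros s n Hs. rewrite <- !iter_sext. apply Hn.
    eapply Rle_lt_trans; [apply chordal_le|lra]. }
  destruct (Hdich x) as [Hx|Hx].
  - destruct (Hesc (delta / 2)) as [s [Hs Hs']]; [lra|].
    destruct (Hs' (2 * R + 1)) as [n Hb].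
    assert (E := chordal_separated _ _ R (Hx n) Hb).
    assert (E' := Hclose s n Hs). lra.
  - destruct (Hbd (delta / 2)) as [s [Hs Hs']]; [lra|].
    destruct (Hx (2 * R + 1)) as [n Hb].
    assert (E := chordal_separated _ _ R (Hs' n) Hb).
    assert (E' := Hclose s n Hs). rewrite chordal_sym in E'. lra.
Qed.

Lemma escape_radius d a p : deg_le d a p -> a <> 0 -> (2 <= d)%nat ->
  exists R, 1 <= R /\ forall z, R < Cmod z -> 2 * Cmod z <= Cmod (p z).
Proof.
  intros Hp Ha Hd.
  destruct (deg_le_growth d a p Hp Ha) as [R [c [HR [Hc H]]]].
  (* Beyond this radius c |z| >= 2, so c |z|^d >= c |z|^2 >= 2 |z|. *)
  exists (R + 2 / c). assert (H2 : 0 < 2 / c) by (apply Rdiv_lt_0_compat; lra).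
  split; [lra|]. intros z Hz.
  eapply Rle_trans; [|apply H; lra].
  apply Rle_trans with (c * Cmod z ^ 2).
  - assert (2 <= c * Cmod z); [|simpl; nra].
    replace 2 with (c * (2 / c)) by (field; lra). apply Rmult_le_compat_l; lra.
  - apply Rmult_le_compat_l; [lra|]. apply Rle_pow; [lra|auto].
Qed.

Lemma iter_escapes p R z : 1 <= R ->
  (forall z, R < Cmod z -> 2 * Cmod z <= Cmod (p z)) ->
  R < Cmod z -> forall B, exists n, B < Cmod (Nat.iter n p z).
Proof.
  intros HR H Hz B.
  (* Doubling a modulus above R >= 1 adds at least 1, so linear growth follows. *)
  assert (Hg : forall n, R < Cmod (Nat.iter n p z) /\ INR n <= Cmod (Nat.iter n p z)).
  { induction n as [|n [I1 I2]]; [simpl; lra|].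
    rewrite S_INR. simpl Nat.iter. assert (E := H _ I1). lra. }
  destruct (INR_unbounded B) as [n Hn]. exists n. destruct (Hg n); lra.
Qed.

Lemma iter_shift {A} (f : A -> A) m n z :
  Nat.iter m f (Nat.iter n f z) = Nat.iter (m + n) f z.
Proof. induction m; simpl; congruence. Qed.

(* On a segment from a fixed point to an escaping point, the last point
   reached through bounded orbits lies in the Julia set. *)
Lemma Julia_nonempty d a p : deg_le d a p -> a <> 0 -> (2 <= d)%nat ->
  exists x, ~ Fatou (sext p) (Some x).
Proof.
  intros Hp Ha Hd.
  destruct (escape_radius d a p Hp Ha Hd) as [R [HR Hesc]].
  destruct d as [|d]; [lia|].
  (* A fixed point is a root of p(z) - z, whose leading coefficient is still a because the degree is
     at least 2. *)
  assert (Hfix : deg_le (S d) (a + 0) (fun z => p z + - (1) * z)%C).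
  { apply deg_le_add; auto. apply deg_le_weaken with 1%nat (- (1))%C; [|lia].
    exists (RtoC 0), (fun _ => (- (1))%C); split; simpl; auto. intros; ring. }
  replace (a + 0)%C with a in Hfix by ring.
  destruct (FTA.poly_root d a _ Hfix Ha) as [x0 Hx0].
  assert (Hp0 : p x0 = x0).
  { replace (p x0) with (p x0 + - (1) * x0 + x0)%C by ring. rewrite Hx0; ring. }
  assert (Hit : forall n, Nat.iter n p x0 = x0) by (induction n; simpl; congruence).
  assert (Hdich : forall s, (forall n, Cmod (Nat.iter n p s) <= R) \/
             forall B, exists n, B < Cmod (Nat.iter n p s)).
  { intros s. destruct (classic (forall n, Cmod (Nat.iter n p s) <= R)) as [|N]; auto.
    right; intros B. apply not_all_ex_not in N. destruct N as [n Hn].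
    destruct (iter_escapes p R (Nat.iter n p s) HR Hesc ltac:(lra) B) as [m Hm].
    exists (m + n)%nat. now rewrite <- iter_shift. }
  assert (Hx0R : Cmod x0 <= R).
  { destruct (Rle_or_lt (Cmod x0) R) as [|N]; auto.
    assert (E := Hesc x0 N). rewrite Hp0 in E. lra. }
  set (w := RtoC (R + 1)).
  assert (Hw : R < Cmod w) by (unfold w; rewrite Cmod_R, Rabs_pos_eq; lra).
  set (z := fun t => (x0 + RtoC t * (w - x0))%C).
  assert (Hz : forall s t, Cmod (z s - z t) = Rabs (s - t) * Cmod (w - x0)).
  { intros s t. rewrite <- Cmod_R, <- Cmod_mult. f_equal. unfold z.
    rewrite RtoC_minus; ring. }
  set (K := fun t => 0 <= t <= 1 /\ forall n, Cmod (Nat.iter n p (z t)) <= R).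
  destruct (completeness K) as [T [HT1 HT2]].
  { exists 1; intros t [Ht _]; lra. }
  { exists 0; split; [lra|]. intros n. unfold z.
    replace (x0 + RtoC 0 * (w - x0))%C with x0 by ring. now rewrite Hit. }
  assert (HT0 : 0 <= T).
  { apply HT1; split; [lra|]. intros n. unfold z.
    replace (x0 + RtoC 0 * (w - x0))%C with x0 by ring. now rewrite Hit. }
  assert (HT01 : T <= 1) by (apply HT2; intros t [Ht _]; lra).
  set (l := Cmod (w - x0) + 1).
  assert (Hl : 0 < l) by (unfold l; generalize (Cmod_ge_0 (w - x0)%C); lra).
  assert (Hnear : forall eta t, 0 < eta -> Rabs (T - t) < eta / l -> Cmod (z T - z t) < eta).
  { intros eta t He Ht. rewrite Hz.
    apply Rmult_lt_compat_r with (r := l) in Ht; auto.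
    unfold Rdiv in Ht; rewrite Rmult_assoc, Rinv_l in Ht by lra.
    generalize (Rabs_pos (T - t)); unfold l in Ht; lra. }
  exists (z T). apply not_Fatou_of_dichotomy with R; auto.
  - intros eta He.
    assert (Hel : 0 < eta / l) by (apply Rdiv_lt_0_compat; auto).
    destruct (classic (exists t, K t /\ T - eta / l < t)) as [[t [[Ht HK] Hlt]]|N].
    + exists (z t); split; auto. apply Hnear; auto.
      assert (t <= T) by (apply HT1; split; auto).
      rewrite Rabs_pos_eq; lra.
    + exfalso. assert (T <= T - eta / l); [|lra].
      apply HT2. intros t Ht. destruct (Rle_or_lt t (T - eta / l)); auto.
      exfalso; apply N; exists t; auto.
  - intros eta He.
    assert (Hel : 0 < eta / l) by (apply Rdiv_lt_0_compat; auto).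
    (* Parameters just above T escape; if T is too close to 1, the escaping endpoint w serves. *)
    destruct (Rle_or_lt (T + eta / l / 2) 1) as [H1|H1].
    + exists (z (T + eta / l / 2)); split.
      * apply Hnear; auto. rewrite <- Rabs_Ropp, Rabs_pos_eq; lra.
      * destruct (Hdich (z (T + eta / l / 2))) as [Hb|]; auto. exfalso.
        assert (T + eta / l / 2 <= T); [|lra]. apply HT1; split; [lra|auto].
    + exists (z 1); split.
      * apply Hnear; auto. rewrite <- Rabs_Ropp, Rabs_pos_eq; lra.
      * apply iter_escapes with R; auto. unfold z.
        replace (x0 + RtoC 1 * (w - x0))%C with w by ring. auto.
Qed.

(** * Convex Julia sets *)

(** The last hypothesis says that S is closed: if the supremum were outside S, a smaller upper bound
    would exist. *)
Lemma closed_has_max (S : R -> Prop) B t0 : S t0 -> (forall t, S t -> t <= B) ->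
  (forall t, ~ S t -> exists r, 0 < r /\ forall s, Rabs (s - t) < r -> ~ S s) ->
  exists M, S M /\ forall t, S t -> t <= M.
Proof.
  intros H0 HB Hc.
  destruct (completeness S) as [M [H1 H2]]; [exists B; exact HB|eauto|].
  exists M; split; auto.
  apply NNPP; intros HM. destruct (Hc M HM) as [r [Hr H]].
  assert (M <= M - r); [|lra].
  apply H2. intros t Ht. destruct (Rle_or_lt t (M - r)); auto.
  exfalso; apply (H t); auto. assert (t <= M) by (apply H1; auto).
  rewrite <- Rabs_Ropp, Rabs_pos_eq; lra.
Qed.

(** In the affine coordinate sending u to 0 and v to 1, w becomes (x, y) with y nonzero. Near the
    centroid all barycentric coordinates stay nonnegative. *)
Lemma convex_triangle_interior (K : C -> Prop) u v w :
  (forall a b c, 0 <= a -> 0 <= b -> 0 <= c -> a + b + c = 1 -> K (a * u + b * v + c * w)%C) ->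
  u <> v -> Im ((w - u) / (v - u))%C <> 0 ->
  exists z r, 0 < r /\ forall z', Cmod (z' - z) < r -> K z'.
Proof.
  intros HK Huv.
  assert (Hvu : (v - u)%C <> 0).
  { intros E; apply Huv. replace v with (v - u + u)%C by ring. rewrite E; ring. }
  destruct ((w - u) / (v - u))%C as [x y] eqn:Ez. simpl; intros Hy.
  assert (Hw : w = (u + (x, y) * (v - u))%C) by (rewrite <- Ez; field; auto).
  (* Chosen so that a displacement below e moves each barycentric coordinate by at most 1/3. *)
  set (e := Rabs y / (3 * (Rabs y + Rabs x + 1))).
  assert (Hy0 : 0 < Rabs y) by now apply Rabs_pos_lt.
  assert (Hx0 := Rabs_pos x).
  assert (He : 0 < e) by (apply Rdiv_lt_0_compat; lra).
  assert (Hm : 0 < Cmod (v - u)) by now apply Cmod_gt_0.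
  exists (u + (v - u) * ((1 + (x, y)) / 3))%C, (e * Cmod (v - u)).
  split; [now apply Rmult_lt_0_compat|].
  intros z Hz.
  destruct ((z - (u + (v - u) * ((1 + (x, y)) / 3))) / (v - u))%C as [s t] eqn:Est.
  assert (C3 : RtoC 3 <> 0) by (intros E; apply RtoC_inj in E; lra).
  assert (Hzz : z = (u + (v - u) * ((1 + (x, y)) / 3 + (s, t)))%C) by (rewrite <- Est; field; auto).
  assert (Hst : Cmod (s, t) < e).
  { rewrite <- Est, Cmod_div by auto. apply Rmult_lt_reg_r with (Cmod (v - u)); auto.
    unfold Rdiv; rewrite Rmult_assoc, Rinv_l; lra. }
  assert (Hmax := Rmax_Cmod (s, t)). simpl in Hmax.
  assert (Hs := Rle_trans _ _ _ (Rmax_l _ _) Hmax).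
  assert (Ht := Rle_trans _ _ _ (Rmax_r _ _) Hmax).
  (* For the displacement (s, t) the weight of w changes by k, that of v by s - x k. *)
  set (k := t / y).
  assert (Hk : Rabs k * Rabs y = Rabs t) by (rewrite <- Rabs_mult; f_equal; unfold k; field; auto).
  assert (Hk0 := Rabs_pos k).
  assert (Hk1 : Rabs k < / (3 * (Rabs y + Rabs x + 1))).
  { apply Rmult_lt_reg_r with (Rabs y); auto.
    rewrite Hk. replace (/ (3 * (Rabs y + Rabs x + 1)) * Rabs y) with e; [lra|].
    unfold e; field; lra. }
  assert (Hsum : Rabs s + Rabs x * Rabs k + Rabs k <= 1 / 3).
  { assert (HD : e + (Rabs x + 1) * / (3 * (Rabs y + Rabs x + 1)) = 1 / 3)
      by (unfold e; field; lra).
    assert ((Rabs x + 1) * Rabs k <= (Rabs x + 1) * / (3 * (Rabs y + Rabs x + 1)))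
      by (apply Rmult_le_compat_l; lra).
    lra. }
  rewrite <- Rabs_mult in Hsum.
  assert (Bs := proj1 (Rabs_le_between _ _) (Rle_refl (Rabs s))).
  assert (Bk := proj1 (Rabs_le_between _ _) (Rle_refl (Rabs k))).
  assert (Bxk := proj1 (Rabs_le_between _ _) (Rle_refl (Rabs (x * k)))).
  assert (E : t = y * k) by (unfold k; field; auto).
  replace z with (RtoC (1 / 3 - s + x * k - k) * u + RtoC (1 / 3 + s - x * k) * v
                  + RtoC (1 / 3 + k) * w)%C.
  - apply HK; lra.
  - rewrite Hzz, Hw, E.
    replace (s, y * k) with (RtoC s + (x, y) * RtoC k - RtoC (x * k))%C
      by (unfold Cminus, Cplus, Copp, Cmult, RtoC; simpl; f_equal; ring).
    rewrite !RtoC_plus, !RtoC_minus, !RtoC_plus, !RtoC_minus, !RtoC_div by lra.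
    field; auto.
Qed.

(** A point off the line through u and v would span a triangle with interior. On the line, the
    closed bounded set of parameters has two extreme points, and convexity fills the gap. *)
Lemma planar_convex_segment (K : C -> Prop) B u v :
  (forall x y z a b c, K x -> K y -> K z -> 0 <= a -> 0 <= b -> 0 <= c -> a + b + c = 1 ->
     K (a * x + b * y + c * z)%C) ->
  (forall z, ~ K z -> exists r, 0 < r /\ forall w, Cmod (w - z) < r -> ~ K w) ->
  (forall z, K z -> Cmod z <= B) ->
  (forall z r, 0 < r -> ~ (forall w, Cmod (w - z) < r -> K w)) ->
  K u -> K v -> u <> v ->
  exists c h : C, h <> 0 /\ forall z, K z <-> unit_segment ((z - c) / h)%C.
Proof.
  intros Hconv Hclosed Hbd Hint Hu Hv Huv.
  assert (Hvu : (v - u)%C <> 0).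
  { intros E; apply Huv. replace v with (v - u + u)%C by ring. rewrite E; ring. }
  assert (Hm : 0 < Cmod (v - u)) by now apply Cmod_gt_0.
  assert (Hline : forall w, K w -> exists t, w = (u + RtoC t * (v - u))%C).
  { intros w Hw. exists (Re ((w - u) / (v - u))%C).
    destruct (Req_dec (Im ((w - u) / (v - u))%C) 0) as [E|E].
    - replace (RtoC (Re ((w - u) / (v - u))%C)) with ((w - u) / (v - u))%C; [field; auto|].
      destruct ((w - u) / (v - u))%C as [x y]. simpl in *. now rewrite E.
    - exfalso. destruct (convex_triangle_interior K u v w) as [z [r [Hr H]]]; auto.
      apply (Hint z r Hr H). }
  set (g := fun t => (u + RtoC t * (v - u))%C) in *.
  assert (Hg : forall s t, Cmod (g s - g t) = Rabs (s - t) * Cmod (v - u)).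
  { intros s t. rewrite <- Cmod_R, <- Cmod_mult. f_equal. unfold g.
    rewrite RtoC_minus; ring. }
  assert (Hg0 : g 0 = u) by (unfold g; ring).
  assert (Hg1 : g 1 = v) by (unfold g; ring).
  assert (Hbound : forall t, K (g t) -> Rabs t <= (B + B) / Cmod (v - u)).
  { intros t Ht. apply Rmult_le_reg_r with (Cmod (v - u)); auto.
    unfold Rdiv; rewrite Rmult_assoc, Rinv_l, Rmult_1_r by lra.
    replace t with (t - 0) by ring. rewrite <- Hg, Hg0.
    assert (E1 := Hbd _ Ht). assert (E2 := Hbd _ Hu).
    generalize (Cmod_triangle (g t) (- u)%C); rewrite Cmod_opp; unfold Cminus; lra. }
  (* The signs e = 1 and e = -1 treat both ends of the segment as maxima. *)
  assert (Hopen : forall e, Rabs e = 1 -> forall t, ~ K (g (e * t)) ->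
    exists r, 0 < r /\ forall s, Rabs (s - t) < r -> ~ K (g (e * s))).
  { intros e He t Ht. destruct (Hclosed _ Ht) as [r [Hr H]].
    exists (r / Cmod (v - u)); split; [now apply Rdiv_lt_0_compat|].
    intros s Hs. apply H. rewrite Hg, <- Rmult_minus_distr_l, Rabs_mult, He, Rmult_1_l.
    apply Rmult_lt_compat_r with (r := Cmod (v - u)) in Hs; auto.
    unfold Rdiv in Hs; rewrite Rmult_assoc, Rinv_l in Hs; lra. }
  destruct (closed_has_max (fun t => K (g (1 * t))) ((B + B) / Cmod (v - u)) 1)
    as [M [HM1 HM2]].
  { now rewrite Rmult_1_l, Hg1. }
  { intros t Ht. rewrite Rmult_1_l in Ht. generalize (Hbound t Ht) (Rle_abs t); lra. }
  { apply Hopen, Rabs_R1. }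
  destruct (closed_has_max (fun t => K (g (-1 * t))) ((B + B) / Cmod (v - u)) 0)
    as [m [Hm1 Hm2]].
  { now rewrite Rmult_0_r, Hg0. }
  { intros t Ht. generalize (Hbound _ Ht) (Rle_abs t).
    replace (-1 * t) with (- t) by ring. rewrite Rabs_Ropp; lra. }
  { apply Hopen. rewrite <- Rabs_Ropp, Rabs_pos_eq; lra. }
  assert (HM : 1 <= M) by (apply HM2; now rewrite Rmult_1_l, Hg1).
  assert (Hm' : 0 <= m) by (apply Hm2; now rewrite Rmult_0_r, Hg0).
  rewrite Rmult_1_l in HM1.
  (* The midpoint and the half-length vector of the segment from g(-m) to g(M). *)
  exists (g ((M - m) / 2)), (RtoC ((M + m) / 2) * (v - u))%C.
  assert (HMm : RtoC ((M + m) / 2) <> 0) by (intros E; apply RtoC_inj in E; lra).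
  split; [now apply Cmult_neq_0|].
  assert (Heq : forall t, ((g t - g ((M - m) / 2)%R) / (RtoC ((M + m) / 2) * (v - u)))%C =
     RtoC ((t - (M - m) / 2) / ((M + m) / 2))).
  { intros t. unfold g. rewrite (RtoC_div (t - (M - m) / 2) ((M + m) / 2) ltac:(lra)), (RtoC_minus t).
    field; auto. }
  intros z; split.
  - intros Hz. destruct (Hline z Hz) as [t E]. change (z = g t) in E. subst z.
    rewrite Heq. eexists; split; [|reflexivity].
    assert (t <= M) by (apply HM2; now rewrite Rmult_1_l).
    assert (- t <= m) by (apply Hm2; now replace (-1 * - t) with t by ring).
    assert (Ek : (t - (M - m) / 2) / ((M + m) / 2) * ((M + m) / 2) = t - (M - m) / 2)
      by (field; lra).
    split; apply Rmult_le_reg_r with ((M + m) / 2); try rewrite Ek; lra.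
  - intros [s [Hs E]].
    (* The third weight is 0, since convexity is stated for three points. *)
    replace z with (RtoC ((1 - s) / 2) * g (-1 * m)%R + RtoC ((1 + s) / 2) * g M + RtoC 0 * g M)%C.
    + apply Hconv; auto; lra.
    + transitivity (g ((M - m) / 2)%R + RtoC s * (RtoC ((M + m) / 2) * (v - u)))%C.
      * unfold g. rewrite !RtoC_div, !RtoC_plus, !RtoC_minus, !RtoC_mult by lra.
        replace (RtoC (-1)) with (- RtoC 1)%C by (rewrite <- RtoC_opp; f_equal; lra).
        field.
      * rewrite <- E. field; auto.
Qed.

Lemma conv_of_subset (X : C -> Prop) x y z a b c : X x -> X y -> X z ->
  0 <= a -> 0 <= b -> 0 <= c -> a + b + c = 1 -> conv X (a * x + b * y + c * z)%C.
Proof.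
  intros Hx Hy Hz Ha Hb Hc Hs.
  exists ((a, x) :: (b, y) :: (c, z) :: nil); split; [|split].
  - repeat (apply Forall_cons; [simpl; auto|]). apply Forall_nil.
  - simpl; lra.
  - simpl; ring.
Qed.

(** All roots of p - z0 equal z0, so |p(z) - z0| = |a| t^d with t = |z - z0|, which is at most t for
    t < min(1, 1/|a|). Orbits starting in this disc stay in it. *)
Lemma superattracting_Fatou d a p z0 : deg_le d a p -> a <> 0 -> (2 <= d)%nat ->
  (forall z, p z = z0 -> z = z0) -> Fatou (sext p) (Some z0).
Proof.
  intros Hp Ha Hd Hfib.
  assert (Hp0 : deg_le d a (fun z => p z - z0)%C).
  { replace a with (a + 0)%C by ring.
    apply (deg_le_add d a 0 p (fun _ => (- z0)%C)); auto.
    apply deg_le_weaken with O (- z0)%C; [simpl; auto|lia]. }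
  destruct (deg_le_split d a _ Hp0 Ha) as [l [Hl E]].
  assert (Hal : forall r, In r l -> r = z0).
  { intros r Hr. apply Hfib. replace (p r) with (p r - z0 + z0)%C by ring.
    rewrite E, prodC_at_root by auto. ring. }
  assert (Ha0 : 0 < Cmod a) by now apply Cmod_gt_0.
  set (rho := Rmin 1 (/ Cmod a)).
  assert (Hrho : 0 < rho) by (apply Rmin_pos; [lra|now apply Rinv_0_lt_compat]).
  assert (Hcontr : forall z, Cmod (z - z0) < rho -> Cmod (p z - z0) <= Cmod (z - z0)).
  { intros z Hz. rewrite E, Cmod_mult.
    assert (H1 := Rlt_le_trans _ _ _ Hz (Rmin_l _ _)).
    assert (H2 := Rlt_le_trans _ _ _ Hz (Rmin_r _ _)).
    assert (H0 := Cmod_ge_0 (z - z0)%C).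
    set (t := Cmod (z - z0)) in *.
    assert (Hprod : Cmod (prodC (fun r => z - r)%C l) <= t ^ d).
    { rewrite <- Hl. apply Cmod_prodC_le. intros r Hr. rewrite (Hal r Hr). apply Rle_refl. }
    assert (Hat : Cmod a * t <= 1).
    { apply Rmult_lt_compat_l with (r := Cmod a) in H2; auto.
      rewrite Rinv_r in H2; lra. }
    assert (Htd : t ^ d <= t ^ 2).
    { replace d with (2 + (d - 2))%nat by lia. rewrite pow_add.
      rewrite <- (Rmult_1_r (t ^ 2)) at 2. apply Rmult_le_compat_l; [apply pow_le; auto|].
      rewrite <- (pow1 (d - 2)). apply pow_incr; lra. }
    apply Rle_trans with (Cmod a * t ^ 2).
    - apply Rmult_le_compat_l; lra.
    - simpl; nra. }
  apply Fatou_of_bounded with d a rho (Cmod z0 + 1); auto.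
  intros n z Hz.
  assert (Hn : Cmod (Nat.iter n p z - z0) < rho).
  { induction n; simpl; auto. eapply Rle_lt_trans; [apply Hcontr|]; auto. }
  assert (H1 := Rlt_le_trans _ _ _ Hn (Rmin_l _ _)).
  replace (Nat.iter n p z) with (Nat.iter n p z - z0 + z0)%C by ring.
  generalize (Cmod_triangle (Nat.iter n p z - z0) z0); lra.
Qed.

Theorem convex_Julia_segment d a p : deg_le d a p -> a <> 0 -> (2 <= d)%nat ->
  (forall x : sphere, ~ Fatou (sext p) x <->
      exists z, x = Some z /\ conv (JuliaC p) z) ->
  (forall z, conv (JuliaC p) (p z) <-> conv (JuliaC p) z) ->
  exists c h : C, h <> 0 /\ forall z, conv (JuliaC p) z <-> unit_segment ((z - c) / h)%C.
Proof.
  intros Hp Ha Hd HJ Hinv. set (H := conv (JuliaC p)) in *.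
  assert (HJH : forall z, H z <-> JuliaC p z).
  { intros z. unfold JuliaC. rewrite HJ. split; [intros; eauto|].
    intros [w [E Hw]]. injection E as ->. auto. }
  (* The Julia set equals a subset of the plane, so it omits a neighbourhood of infinity and H is
     bounded. *)
  assert (Hinf : Fatou (sext p) None).
  { apply NNPP. intros N. apply HJ in N. destruct N as [z [E _]]. discriminate. }
  destruct (Fatou_infinity _ Hinf) as [B HB].
  assert (Hbd : forall z, H z -> Cmod z <= B).
  { intros z Hz. apply HJH in Hz. destruct (Rle_or_lt (Cmod z) B) as [|N]; auto.
    destruct (Hz (HB z N)). }
  destruct (Julia_nonempty d a p Hp Ha Hd) as [u Hu].
  change (JuliaC p u) in Hu. apply HJH in Hu.
  assert (Hiter : forall n z, H z -> H (Nat.iter n p z)).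
  { intros n z Hz; induction n; simpl; auto. now apply Hinv. }
  destruct (classic (exists v, H v /\ u <> v)) as [[v [Hv Huv]]|N].
  - apply (planar_convex_segment H B u v); auto.
    + intros x y z s t r Hx Hy Hz. rewrite HJH in Hx, Hy, Hz. now apply conv_of_subset.
    (* H is closed because its complement in the plane is the open Fatou set. *)
    + intros z Hz. rewrite HJH in Hz. apply NNPP in Hz.
      destruct (Fatou_open _ _ Hz) as [r [Hr HF]]. exists r; split; auto.
      intros w Hw N. apply HJH in N. now apply N, HF.
    (* A disc inside H has all its iterates in H, hence bounded by B, and its centre would be a
       Fatou point. *)
    + intros z r Hr Hball.
      assert (Hz : H z) by (apply Hball; replace (z - z)%C with (RtoC 0) by ring; now rewrite Cmod_0).
      apply HJH in Hz. apply Hz. apply Fatou_of_bounded with d a r B; auto.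
  (* If H = {u}, backward invariance makes u its own only preimage. *)
  - exfalso. assert (Hu' := Hu). apply HJH in Hu'. apply Hu'.
    apply superattracting_Fatou with d a; auto.
    intros z Hz. apply NNPP; intros Hne. apply N. exists z; split; auto.
    apply Hinv. now rewrite Hz.
Qed.

(** * Conjugation to a Chebyshev polynomial *)

Theorem mainTheorem6 (d : nat) (cs : list C) :
  (2 <= d)%nat -> length cs = S d -> nth d cs (RtoC 0) <> RtoC 0 ->
  (* J_p = H_p as subsets of the Riemann sphere, H_p = conv J_p *)
  (forall x : sphere, ~ Fatou (sext (peval cs)) x <->
      exists z, x = Some z /\ conv (JuliaC (peval cs)) z) ->
  (* p^{-1}(H_p) = H_p *)
  (forall z, conv (JuliaC (peval cs)) (peval cs z) <-> conv (JuliaC (peval cs)) z) ->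
  exists a b : C, a <> RtoC 0 /\
    ((forall w, Cplus (Cmult a (peval cs (Cdiv (Cminus (ccos w) b) a))) b
                = ccos (Cmult (RtoC (INR d)) w)) \/
     (forall w, Cplus (Cmult a (peval cs (Cdiv (Cminus (ccos w) b) a))) b
                = Copp (ccos (Cmult (RtoC (INR d)) w)))).
Proof.
  intros Hd Hlen Ha HJ Hinv.
  assert (Hp := peval_deg_le cs d Hlen).
  set (p := peval cs) in *. set (a := nth d cs (RtoC 0)) in *.
  destruct (convex_Julia_segment d a p Hp Ha Hd HJ Hinv) as [c [h [Hh Hseg]]].
  (* The map y -> h y + c carries [-1,1] onto H, so its conjugate q of p leaves [-1,1] completely
     invariant. *)
  set (q := fun y => (/ h * (p (h * y + c) + - c))%C).
  assert (Hq : deg_le d (/ h * (a * h ^ d + 0))%C q).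
  { apply deg_le_scal, deg_le_add; [now apply deg_le_comp_affine|].
    apply deg_le_weaken with O (- c)%C; [simpl; auto|lia]. }
  assert (Hh' : (/ h)%C <> 0).
  { intros E. assert (E1 : RtoC 1 = (/ h * h)%C) by (field; auto).
    rewrite E, Cmult_0_l in E1. apply RtoC_inj in E1; lra. }
  assert (Hq0 : (/ h * (a * h ^ d + 0))%C <> 0).
  { rewrite Cplus_0_r. apply Cmult_neq_0; auto. apply Cmult_neq_0; auto. now apply Cpow_nz. }
  assert (Hqinv : forall z, unit_segment (q z) <-> unit_segment z).
  { intros z.
    replace (q z) with ((p (h * z + c) - c) / h)%C by (unfold q; field; auto).
    rewrite <- Hseg, Hinv, Hseg.
    now replace ((h * z + c - c) / h)%C with z by (field; auto). }
  (* The inverse map g(z) = (z - c)/h, so that g p g^(-1) = q. *)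
  exists (/ h)%C, (- (c / h))%C. split; auto.
  assert (Hconj : forall y, (/ h * p ((y - - (c / h)) / / h) + - (c / h))%C = q y).
  { intros y. unfold q.
    replace ((y - - (c / h)) / / h)%C with (h * y + c)%C by (field; auto).
    field; auto. }
  destruct (cheb_of_invariant_unit_segment d _ q Hq Hq0 ltac:(lia) Hqinv) as [E|E];
    [left|right]; intros w; now rewrite Hconj, E, cheb_ccos.
Qed.
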